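(* Let $\mathcal{E}:=(\Omega|K,v)$ be a finite Galois extension of henselian non-trivially valued fields. Assume that $\operatorname{depth}(\mathcal{E})=1$ and that $\mathcal{E}$ is not tame. Set $L:=\Omega\cap K^r$. Then for any generator $a$ of $\Omega|K$ such that $a$ is pure over $K$, we have $$\#\operatorname{Ram}(\mathcal{E})\leq \#S_L(a).$$ In particular, if $\mathcal{E}$ is purely wild, then $\#\operatorname{Ram}(\mathcal{E})\leq\#S_K(a)$. Equality holds in these inequalities whenever $\mathcal{E}$ is defectless or $\operatorname{rank}(K,v)=1$.
   Context: $\overline{K}\supseteq\Omega$ is a fixed algebraic closure of $K$, $K^{\mathrm{sep}}\subseteq\overline K$ the separable-algebraic closure; the unique extension of $v$ to $\overline K$ is again denoted $v$. $vF$ and $Fv$ denote the value group and residue field of a field $F$ with $K\subseteq F\subseteq\overline K$, $\mathcal O_F$ its valuation ring and $\mathcal M_F$ the maximal ideal; $\deg_F(b)=[F(b):F]$. The characteristic exponent $p$ is $1$ if $\operatorname{char} Kv=0$ and $p=\operatorname{char}Kv$ otherwise. The rank of $(K,v)$ is the rank of the ordered group $vK$ (rank one means archimedean and non-trivial). For a field $F$ with $K\subseteq F\subseteq\overline K$, $S_F(a) := \{ v(a-a^\prime) \mid a^\prime\neq a \text{ is an } F\text{-conjugate of } a\}$. Ramification ideals: let $\mathcal G=\mathrm{Gal}(\Omega|K)$. For a subgroup $H$ of $\mathcal G$ let $\mathcal I_H$ be the ideal of $\mathcal O_\Omega$ generated by all $\frac{\sigma z}{z}-1$ with $\sigma\in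 H$, $z\in\Omega^\times$. A ramification ideal of $\mathcal E$ is an ideal $\mathcal I$ of $\mathcal O_\Omega$ with $(0)\subsetneq\mathcal I\subseteq\mathcal M_\Omega$ and $\mathcal I=\mathcal I_H$ for some subgroup $H$ of $\mathcal G$. $\operatorname{Ram}(\mathcal E)$ is the set of ramification ideals of $\mathcal E$. Defect: for a finite extension $(E|K,v)$, $[E:K]=(vE:vK)[Ev:Kv]\,d(E|K,v)$, where the defect $d(E|K,v)$ is a power of $p$; the extension is defectless if $d(E|K,v)=1$. Tame: an algebraic extension $(E|K,v)$ is tame if every finite subextension $(E'|K,v)$ satisfies: $(vE':vK)$ is coprime to $p$, $E'v|Kv$ is separable, and $d(E'|K,v)=1$. $K^r$ (absolute ramification field) is the fixed field in $K^{\mathrm{sep}}$ of $G^r=\{\sigma\in\mathrm{Gal}(\overline K|K)\mid v(\sigma x-x)>vx \text{ for all } x\in K^{\mathrm{sep}}\setminus\{0\}\}$. Purely wild: $(E|K,v)$ algebraic is purely wild if $vE/vK$ is a $p$-group and $Ev|Kv$ is purely inseparable; equivalently $E\cap K^r=K$. Depth and purity: for a positive integer $d<\deg_K(a)$ put $D_d:=\{v(z-a)\mid z\in\overline K,\ \deg_K(z)=d\}$. An Okutsu sequence of $a$ over $K$ is a finite sequence $A_0=\{a\},A_1,\dots,A_n$ of subsets of $\overline K$, all elements of $A_i$ having the same degree $d_i$ over $K$, such that: (OS1) $\deg_K(a)=d_0>d_1>\dots>d_n=1$; (OS2) for all $i\geq1$ and $z\in\overline K$ with $\deg_K(z)<d_{i-1}$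 there is $z_i\in A_i$ with $v(a-z_i)\geq v(a-z)$; (OS3) $v(a-z_{i-1})>v(a-z_i)$ for all $i\ge 1$, $z_i\in A_i$, $z_{i-1}\in A_{i-1}$; (OS4) for $i\geq 1$, $\#A_i=1$ if and only if $\max D_{d_i}$ exists, and then $A_i=\{a_i\}$ with $v(a-a_i)=\max D_{d_i}=\max\{v(a-z)\mid \deg_K(z)<d_{i-1}\}$; (OS5) if $\max D_{d_i}$ does not exist, then $A_i=\{z_\nu\}_{\nu<\lambda}$ with $\lambda$ a limit ordinal and $v(a-z_\mu)>v(a-z_\nu)$ for all $\nu<\mu<\lambda$. Every $a\in\overline K\setminus K$ admits an Okutsu sequence, and all its Okutsu sequences have the same length $n$, called the depth $\ell(a)=\ell_K(a)$ of $a$ over $K$. The element $a$ is pure over $K$ if $\ell_K(a)=1$. The depth of the extension is $\operatorname{depth}(\mathcal E):=\min\{\ell_K(a)\mid a \text{ is a generator of }\Omega|K\}$, where a generator is an element $a$ with $\Omega=K(a)$. *)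

(* Defs.v *)
From HB Require Import structures.
From mathcomp Require Import all_boot all_order all_fingroup all_algebra all_field.
From mathcomp Require Import boolp classical_sets functions cardinality.

Set Implicit Arguments.
Unset Strict Implicit.
Unset Printing Implicit Defensive.

Import Order.TTheory GRing.Theory Num.Theory.

Local Open Scope classical_set_scope.
Local Open Scope ring_scope.

(* Totally ordered abelian groups. [Num.POrderedZmodule] has no axiom relating
   the order to the addition. Totality is an axiom here, and not inherited from
   [Order.Total], because the hierarchy of numeric structures leaves no room for
   a join of [Order.Total] and [GRing.Zmodule] below [Num.RealDomain]. *)

HB.mixin Record isOrderedGroup G of Num.POrderedZmodule G := {
  oag_leD2l : forall x y z : G, x <= y -> z + x <= z + y;
  oag_le_total : forall x y : G, (x <= y) || (y <= x)
}.

#[short(type="oagType")]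
HB.structure Definition OrderedGroup :=
  { G of Num.POrderedZmodule G & isOrderedGroup G }.

Variant vext (G : Type) := VFin of G | VInf.
Arguments VInf {G}.

Section Vext.
Variable G : oagType.
Implicit Types a b : vext G.

Definition vext_opt a : option G := if a is VFin g then Some g else None.
Definition opt_vext (o : option G) : vext G := if o is Some g then VFin g else VInf.
Lemma vext_optK : cancel vext_opt opt_vext. Proof. by case. Qed.

HB.instance Definition _ := Choice.copy (vext G) (can_type vext_optK).

Definition vext_le a b : bool :=
  match a, b with
  | _, VInf => true
  | VInf, VFin _ => false
  | VFin x, VFin y => x <= y
  end.

Lemma vext_le_refl : reflexive vext_le.
Proof. by case=> [x|] //=; rewrite lexx. Qed.
Lemma vext_le_anti : antisymmetric vext_le.
Proof. by case=> [x|] [y|] //= /le_anti->. Qed.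
Lemma vext_le_trans : transitive vext_le.
Proof. by case=> [y|] [x|] [z|] //=; apply: le_trans. Qed.

HB.instance Definition _ := Order.Le_isPOrder.Build ring_display (vext G)
  vext_le_refl vext_le_anti vext_le_trans.

Lemma vext_le_total : total (<=%O : rel (vext G)).
Proof. by case=> [x|] [y|] //=; apply: oag_le_total. Qed.

HB.instance Definition _ :=
  Order.POrder_isTotal.Build ring_display (vext G) vext_le_total.

Definition vext_add a b : vext G :=
  if a is VFin x then (if b is VFin y then VFin (x + y) else VInf) else VInf.

End Vext.

Record valuation (F : fieldType) (G : oagType) := Valuation {
  vfun :> F -> vext G;
  v_eqInf : forall x, vfun x = VInf <-> x = 0;
  v_mul : forall x y, vfun (x * y) = vext_add (vfun x) (vfun y);
  v_add : forall x y, Order.min (vfun x) (vfun y) <= vfun (x + y)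
}.

Section ResidueField.
Variables (F : fieldType) (G : oagType) (v : valuation F G).

Lemma v_one : v 1 = VFin 0.
Proof.
case E: (v 1) => [g|]; last by move/v_eqInf/eqP: E; rewrite oner_eq0.
have := v_mul v 1 1; rewrite mulr1 E => -[] /esym/eqP.
by rewrite -subr_eq0 addrK => /eqP->.
Qed.

Lemma v_opp x : v (- x) = v x.
Proof.
have vN1 : v (-1) = VFin 0.
  case E: (v (-1)) => [g|]; last first.
    by move/v_eqInf/eqP: E; rewrite oppr_eq0 oner_eq0.
  have := v_mul v (-1) (-1); rewrite mulrNN mulr1 v_one E => -[] g2.
  have /orP[g0|g0] := oag_le_total 0 g.
    have := oag_leD2l 0 g g g0; rewrite addr0 -g2 => g1.
    by congr VFin; apply: le_anti; rewrite g0 g1.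
  have := oag_leD2l g 0 g g0; rewrite addr0 -g2 => g1.
  by congr VFin; apply: le_anti; rewrite g1 g0.
by rewrite -mulN1r v_mul vN1; case: (v x) => //= g; rewrite add0r.
Qed.

Definition vring : {pred F} := [pred x | VFin 0 <= v x].

Lemma vring_subring : subring_closed vring.
Proof.
split=> [|x y|x y]; rewrite !inE ?v_one //.
  move=> x0 y0; apply: le_trans (v_add v _ _).
  by rewrite le_min x0 v_opp.
rewrite v_mul; case: (v x) (v y) => [a|] [b|] //= a0 b0.
by apply: le_trans a0 _; have := oag_leD2l 0 b a b0; rewrite addr0.
Qed.
HB.instance Definition _ := GRing.isSubringClosed.Build F vring vring_subring.

Record vring_type := VRing { vring_val :> F; _ : vring_val \in vring }.
HB.instance Definition _ := [isSub for vring_val].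
HB.instance Definition _ := [Choice of vring_type by <:].
HB.instance Definition _ := [SubChoice_isSubComNzRing of vring_type by <:].

Definition vmax : {pred vring_type} := [pred x | VFin 0 < v (val x)].

Lemma vmax_ideal : idealr_closed vmax.
Proof.
split=> [||a x y]; rewrite ?inE /=.
- by rewrite (_ : v 0 = VInf) //; apply/v_eqInf.
- by rewrite v_one ltxx.
move=> x0 y0; apply: lt_le_trans (v_add v _ _); rewrite lt_min {}y0 andbT /=.
have a0 : VFin 0 <= v (val a) by case: a.
move: a0 x0; rewrite v_mul; case: (v (val a)) (v x) => [b|] [c|] //= b0 c0.
by apply: lt_le_trans c0 _; have := oag_leD2l 0 b c b0; rewrite addr0 addrC.
Qed.
HB.instance Definition _ := isIdealr.Build vring_type vmax vmax_ideal.

Definition resfield := {ideal_quot vmax}.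
HB.instance Definition _ := GRing.ComNzRing.on resfield.

Definition respi (x : vring_type) : resfield := \pi_({ideal_quot vmax})%qT x.

Lemma respi1 : respi 1 = 1. Proof. exact: rmorph1. Qed.
Lemma respiM x y : respi (x * y) = respi x * respi y.
Proof. exact: rmorphM. Qed.
Lemma respi_eq0 x : (respi x == 0) = (x \in vmax).
Proof.
have -> : 0 = respi 0 by rewrite /respi rmorph0.
by rewrite -[x in RHS]subr0 Quotient.idealrBE.
Qed.
Lemma respi_repr (x : resfield) : respi (generic_quotient.repr x) = x.
Proof. exact: reprK. Qed.

(* Inverse of a residue class, read off a representative. *)
Definition vring_inv (x : vring_type) : vring_type := insubd 0 ((val x)^-1).
Definition res_inv (x : resfield) : resfield :=
  if x == 0 then 0 else respi (vring_inv (generic_quotient.repr x)).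

Lemma res_mulVf x : x != 0 -> res_inv x * x = 1.
Proof.
move=> x0; rewrite /res_inv (negPf x0).
move: x0; rewrite -{1 3}[x]respi_repr respi_eq0.
move: (generic_quotient.repr x) => y; rewrite inE -leNgt => y0.
have [u uE] : exists u : F, u = val y by exists (val y).
have vu : v u = VFin 0.
  by rewrite uE; apply: le_anti; rewrite y0; case: y {y0 uE}.
have u0 : u != 0 by apply/eqP => /(v_eqInf v); rewrite vu.
have uV : u^-1 \in vring.
  rewrite inE; have := v_mul v u^-1 u; rewrite mulVf // v_one vu.
  by case: (v _) => //= g; rewrite addr0 => ->.
have yV : val (vring_inv y) = u^-1 by rewrite /vring_inv -uE insubdK.
rewrite -respiM -respi1; congr respi; apply: val_inj.
by transitivity (val (vring_inv y) * val y); rewrite // yV -uE mulVf.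
Qed.
Lemma res_inv0 : res_inv 0 = 0. Proof. by rewrite /res_inv eqxx. Qed.

HB.instance Definition _ :=
  GRing.ComNzRing_isField.Build resfield res_mulVf res_inv0.

End ResidueField.

(* Subfields of a field M as sets, so that infinite algebraic extensions and
   residue fields are covered. *)
Section Subfields.
Variable M : fieldType.
Implicit Types (F E : set M) (x : M).

Definition is_subfield F : Prop :=
  F 1 /\ forall x y, F x -> F y -> F (x - y) /\ F (x / y).

Definition adjoin F x : set M := smallest is_subfield (F `|` [set x]).

Definition is_basis F E n (b : 'I_n -> M) : Prop :=
  (forall i, E (b i)) /\
  (forall x, E x -> exists! c : {ffun 'I_n -> M},
     (forall i, F (c i)) /\ x = \sum_(i < n) c i * b i).

Definition finite_ext F E : Prop := exists n (b : 'I_n -> M), is_basis F E b.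

(* [E : F], with value 0 if the extension is infinite. *)
Definition ext_degree F E : nat :=
  xget 0%N [set n | exists b : 'I_n -> M, is_basis F E b].

Definition elt_degree F x : nat := ext_degree F (adjoin F x).

Definition poly_over F (p : {poly M}) : Prop := forall i, F p`_i.

Definition is_minpoly F x (p : {poly M}) : Prop :=
  [/\ p \is monic, poly_over F p, root p x &
      forall q, poly_over F q -> q != 0 -> root q x -> (size p <= size q)%N].

Definition conjugate_over F x y : Prop := exists2 p, is_minpoly F x p & root p y.

Definition separable_over F x : Prop :=
  exists2 p, is_minpoly F x p & separable_poly p.

Definition algebraic_ext F E : Prop :=
  forall x, E x -> exists p, [/\ poly_over F p, p != 0 & root p x].

Definition separable_ext F E : Prop := forall x, E x -> separable_over F x.

Definition char_exponent : nat := xget 1%N [set p | p \in [pchar M]].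

Definition purely_inseparable_ext F E : Prop :=
  forall x, E x -> exists n, F (x ^+ (char_exponent ^ n)%N).

End Subfields.

(* The least element of S, with value 0 if S is empty. *)
Definition nat_min (S : set nat) : nat :=
  xget 0%N [set m | S m /\ forall k, S k -> (m <= k)%N].

Section OrderedGroups.
Variable G : oagType.
Implicit Types A B : set G.

(* (B : A), with value 0 if the index is infinite. *)
Definition group_index A B : nat :=
  xget 0%N [set n | exists b : 'I_n -> G,
    (forall i, B (b i)) /\ forall x, B x -> exists! i, A (x - b i)].

Definition rank_one A : Prop :=
  (exists2 g, A g & g != 0) /\
  (forall x y, A x -> A y -> 0 < x -> exists n, y <= x *+ n).

Definition is_max (S : set (vext G)) (m : vext G) : Prop :=
  S m /\ forall s, S s -> s <= m.

End OrderedGroups.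

(* Valuation theory of the subfields of a valued field (M, v), to be used for M
   an algebraic closure of the base field K. *)
Section ValuedSubfields.
Variables (M : fieldType) (G : oagType) (v : valuation M G).
Implicit Types (K F E : set M) (a x z : M).

Definition value_group F : set G := [set g | exists2 x, F x & v x = VFin g].

Definition residue_set F : set (resfield v) :=
  [set respi x | x in [set x : vring_type v | F (val x)]].

Definition ramification_index F E : nat :=
  group_index (value_group F) (value_group E).

Definition residue_degree F E : nat :=
  ext_degree (residue_set F) (residue_set E).

(* K v has the same characteristic as M v, for every subfield K of M. *)
Definition residue_char_exponent : nat := char_exponent (resfield v).

(* The extension of v|K to the algebraic closure M is unique. Extensions with
   values in G suffice: M is algebraic over K, so the value group of any of them
   embeds over vK into the divisible hull of vK, which is the value group of v. *)
Definition henselian K : Prop :=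
  forall w : valuation M G, (forall x, K x -> w x = v x) -> forall x, w x = v x.

Definition nontrivially_valued K : Prop := exists2 g, value_group K g & g != 0.

Definition defect F E : nat :=
  xget 0%N [set d |
    ext_degree F E = (ramification_index F E * residue_degree F E * d)%N].

Definition defectless F E : Prop := defect F E = 1%N.

Definition tame F E : Prop :=
  algebraic_ext F E /\
  forall E', is_subfield E' -> F `<=` E' -> E' `<=` E -> finite_ext F E' ->
    [/\ coprime (ramification_index F E') residue_char_exponent,
        separable_ext (residue_set F) (residue_set E') &
        defect F E' = 1%N].

Definition purely_wild F E : Prop :=
  [/\ algebraic_ext F E,
      forall g, value_group E g ->
        exists n, value_group F (g *+ (residue_char_exponent ^ n)%N) &
      purely_inseparable_ext (residue_set F) (residue_set E)].

Definition abs_ramification_group K : set {rmorphism M -> M} :=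
  [set s : {rmorphism M -> M} |
    [/\ bijective s, forall x, K x -> s x = x &
        forall x, separable_over K x -> x != 0 -> v x < v (s x - x)]].

Definition abs_ramification_field K : set M :=
  [set x | separable_over K x /\
    forall s, abs_ramification_group K s -> s x = x].

Definition conj_dist F a : set (vext G) :=
  [set v (a - a') | a' in [set a' | a' <> a /\ conjugate_over F a a']].

Definition deg_dist K a (d : nat) : set (vext G) :=
  [set v (z - a) | z in [set z | elt_degree K z = d]].

(* A family of points indexed by a limit ordinal (a non-empty well-order without
   last element) and getting strictly closer to a. *)
Definition increasing_family a (A : set M) : Prop :=
  exists (disp : Order.disp_t) (I : orderType disp) (z : I -> M),
    [/\ well_founded (fun i j : I => (i < j)%O),
        inhabited I,
        forall i : I, exists j : I, (i < j)%O,
        A = range z &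
        forall i j : I, (i < j)%O -> v (a - z i) < v (a - z j)].

(* Only the sets A 0, ..., A n are relevant. *)
Definition okutsu_sequence K a (n : nat) (A : nat -> set M) : Prop :=
  A 0%N = [set a] /\
  exists d : nat -> nat,
    (forall i, (i <= n)%N -> forall z, A i z -> elt_degree K z = d i) /\
    [/\ [/\ d 0%N = elt_degree K a, d n = 1%N &
            forall i, (i < n)%N -> (d i.+1 < d i)%N],
        forall i, (i < n)%N -> forall z, (elt_degree K z < d i)%N ->
          exists2 z', A i.+1 z' & v (a - z) <= v (a - z'),
        forall i, (i < n)%N -> forall z z', A i z -> A i.+1 z' ->
          v (a - z') < v (a - z),
        forall i, (i < n)%N ->
          ((exists b, A i.+1 = [set b]) <->
             (exists m, is_max (deg_dist K a (d i.+1)) m)) /\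
          (forall b, A i.+1 = [set b] ->
             is_max (deg_dist K a (d i.+1)) (v (a - b)) /\
             is_max [set v (a - z) | z in [set z | (elt_degree K z < d i)%N]]
               (v (a - b))) &
        forall i, (i < n)%N ->
          ~ (exists m, is_max (deg_dist K a (d i.+1)) m) ->
          increasing_family a (A i.+1)].

(* All Okutsu sequences of a have the same length; the value is 0 if a has none. *)
Definition elt_depth K a : nat :=
  xget 0%N [set n | exists A, okutsu_sequence K a n A].

Definition pure K a : Prop := elt_depth K a = 1%N.

Definition generator K E a : Prop := E = adjoin K a.

Definition ext_depth K E : nat :=
  nat_min [set elt_depth K a | a in [set a | generator K E a]].

End ValuedSubfields.

Section Pullback.
Variables (E M : fieldType) (G : oagType).
Variables (iota : {rmorphism E -> M}) (v : valuation M G).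

Lemma pullback_eqInf x : v (iota x) = VInf <-> x = 0.
Proof.
rewrite v_eqInf; split=> [/eqP|->]; last exact: rmorph0.
by rewrite fmorph_eq0 => /eqP.
Qed.
Lemma pullback_mul x y : v (iota (x * y)) = vext_add (v (iota x)) (v (iota y)).
Proof. by rewrite rmorphM v_mul. Qed.
Lemma pullback_add x y :
  Order.min (v (iota x)) (v (iota y)) <= v (iota (x + y)).
Proof. by rewrite rmorphD v_add. Qed.

Definition val_pullback : valuation E G :=
  Valuation pullback_eqInf pullback_mul pullback_add.

End Pullback.

Section RamificationIdeals.
Variables (K : fieldType) (Omega : splittingFieldType K) (G : oagType).
Variable v : valuation Omega G.

Definition vring_ideal (I : set Omega) : Prop :=
  [/\ I `<=` [set x | VFin 0 <= v x],
      I 0,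
      forall x y, I x -> I y -> I (x + y) &
      forall c x, VFin 0 <= v c -> I x -> I (c * x)].

Definition subgroup_ideal (H : {group gal_of {:Omega}}) : set Omega :=
  smallest vring_ideal
    [set x | exists s z, [/\ s \in H, z != 0 & x = s z / z - 1]].

Definition ramification_ideals : set (set Omega) :=
  [set I | [/\ exists2 x, I x & x != 0,
               I `<=` [set x | VFin 0 < v x] &
               exists2 H : {group gal_of {:Omega}},
                 H \subset 'Gal({:Omega} / 1)%g & I = subgroup_ideal H]].

End RamificationIdeals.

Definition base_set (K : fieldType) (Omega : fieldExtType K) (M : fieldType)
  (iota : {rmorphism Omega -> M}) : set M := range (fun c : K => iota c%:A).

(* Main.v *)
Require Import Defs.
From HB Require Import structures.
From mathcomp Require Import all_boot all_order all_fingroup all_algebra all_field.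
From mathcomp Require Import mpoly ring.
From mathcomp Require Import boolp classical_sets functions cardinality filter.

Set Implicit Arguments.
Unset Strict Implicit.
Unset Printing Implicit Defensive.

Import Order.TTheory GRing.Theory Num.Theory.

Local Open Scope classical_set_scope.
Local Open Scope card_scope.
Local Open Scope ring_scope.

(** Let R be the group of the s in Gal(Omega | K) with v (s z - z) > v z for all
    nonzero z. It is the image of the absolute ramification group, so that the
    L-conjugates of a are the s a with s in R. If s is in R and z = f(a) with
    deg f < [Omega : K], then s z / z is the product of the
    1 + (s a - a) / (a - r) over the roots r of f. Since a is pure, some k in K is
    at least as close to a as all these roots, and s z / z - 1 is a multiple of
    (s a - a) / (a - k). Hence the ramification ideal of a subgroup H of R is
    { x | v x >= g - v (a - k) for some k in K }, with g the least of the
    v (s a - a) for s in H \ {1}, and the ramification ideals are the images of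
    the elements g of S_L(a). Two of them coincide only if the set of the
    v (a - k) has no maximum and is stable under some positive shift, which is
    impossible in the defectless case (a basis adapted to v provides a maximum)
    and in rank one (that set is bounded). *)

(** * Valuations *)

(** The delicate point is that R is the whole image of the absolute ramification group. That group
    is defined by an inequality at all separable elements of the closure, so each s in R needs a
    lift t to M with v (t x - x) > v x. An arbitrary lift s' of s need not satisfy this. Composing
    s' with a suitable automorphism h over Omega achieves it on any given finite set, and
    compactness then yields one lift for all x. In the finite case, a product of linear forms over
    an orbit reduces the search for h to a comparison of coefficients fixed over Omega. Such
    coefficients may be purely inseparable over Omega, and not in Omega, so they need an estimate of
    their own. The henselian hypothesis enters through the invariance of v under automorphisms over
    K. *)

Section Valuation.
Variables (F : fieldType) (G : oagType) (v : valuation F G).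
Implicit Types x y z : F.

Lemma v_zero : v 0 = VInf. Proof. exact/v_eqInf. Qed.

Lemma v_le_inf (a : vext G) : a <= VInf. Proof. by case: a. Qed.

Lemma vext_lt_fin (g h : G) : (VFin g < VFin h) = (g < h).
Proof. by rewrite !lt_neqAle; congr (_ && _). Qed.

Lemma v_fin x : x != 0 -> exists g, v x = VFin g.
Proof. by case E: (v x) => [g|]; [exists g|move/v_eqInf/eqP: E ->]. Qed.

Lemma v_lt_inf x : (v x < VInf) = (x != 0).
Proof.
have [->|/v_fin[g ->]] := eqVneq x 0; first by rewrite v_zero ltxx.
by rewrite lt_neqAle v_le_inf andbT; apply/eqP.
Qed.

Lemma v_le_mul2l x y z : x != 0 -> (v (x * y) <= v (x * z)) = (v y <= v z).
Proof.
move=> /v_fin[g vx]; rewrite !v_mul vx.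
case: (v y) (v z) => [a|] [b|] //=; apply/idP/idP => [/(oag_leD2l _ _ (- g))|].
  by rewrite !addKr.
exact: oag_leD2l.
Qed.

Lemma v_lt_mul2l x y z : x != 0 -> (v (x * y) < v (x * z)) = (v y < v z).
Proof. by move=> x0; rewrite !ltNge v_le_mul2l. Qed.

Lemma v_le_div x y : x != 0 -> (VFin 0 <= v (y / x)) = (v x <= v y).
Proof. by move=> x0; rewrite -(v_one v) -(v_le_mul2l _ _ x0) mulr1 mulrC divfK. Qed.

Lemma v_lt_div x y : x != 0 -> (VFin 0 < v (y / x)) = (v x < v y).
Proof. by move=> x0; rewrite -(v_one v) -(v_lt_mul2l _ _ x0) mulr1 mulrC divfK. Qed.

Lemma v_divE x y g h : v x = VFin g -> v y = VFin h -> v (x / y) = VFin (g - h).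
Proof.
move=> xg yh; have y0 : y != 0 by rewrite -(v_lt_inf y) yh.
have := v_mul v (x / y) y; rewrite divfK // xg yh.
by case: (v _) => //= e [->]; rewrite addrK.
Qed.

Lemma v_eq_neq0 x y : v x = v y -> x != 0 -> y != 0.
Proof. by rewrite -!v_lt_inf => ->. Qed.

Lemma v_mulE x x' y y' : v x = v x' -> v y = v y' -> v (x * y) = v (x' * y').
Proof. by rewrite !v_mul => -> ->. Qed.

Lemma v_expE x y n : v x = v y -> v (x ^+ n) = v (y ^+ n).
Proof. by move=> xy; elim: n => // n IH; rewrite !exprS; apply: v_mulE. Qed.

Lemma v_prodE (I : Type) (r : seq I) (P : pred I) (f g : I -> F) :
  (forall i, P i -> v (f i) = v (g i)) ->
  v (\prod_(i <- r | P i) f i) = v (\prod_(i <- r | P i) g i).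
Proof. by move=> fg; elim/big_rec2: _ => // i y x /fg; apply: v_mulE. Qed.

Lemma v_ge_add a x y : a <= v x -> a <= v y -> a <= v (x + y).
Proof. by move=> ax ay; apply: le_trans (v_add v _ _); rewrite le_min ax. Qed.

Lemma v_gt_add a x y : a < v x -> a < v y -> a < v (x + y).
Proof. by move=> ax ay; apply: lt_le_trans (v_add v _ _); rewrite lt_min ax. Qed.

Lemma v_ge_sub a x y : a <= v x -> a <= v y -> a <= v (x - y).
Proof. by move=> ax ay; apply: v_ge_add; rewrite ?v_opp. Qed.

Lemma v_gt_sub a x y : a < v x -> a < v y -> a < v (x - y).
Proof. by move=> ax ay; apply: v_gt_add; rewrite ?v_opp. Qed.

Lemma v_sub_sym x y : v (x - y) = v (y - x).
Proof. by rewrite -(v_opp v (x - y)) opprB. Qed.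

Lemma v_gt_sum g (I : Type) (r : seq I) (P : pred I) (f : I -> F) :
  (forall i, P i -> VFin g < v (f i)) -> VFin g < v (\sum_(i <- r | P i) f i).
Proof. by move=> af; elim/big_rec: _ => [|i x /af]; [rewrite v_zero|exact: v_gt_add]. Qed.

Lemma v_add_eq x y : v x < v y -> v (x + y) = v x.
Proof.
move=> xy; apply/le_anti/andP; split; last by rewrite v_ge_add // ltW.
rewrite leNgt; apply/negP => xxy; have := v_gt_sub xxy xy.
by rewrite addrK ltxx.
Qed.

Lemma v_maxM x y : VFin 0 <= v x -> VFin 0 < v y -> VFin 0 < v (x * y).
Proof.
rewrite v_mul; case: (v x) (v y) => [a|] [b|] // a0 b0.
by apply: lt_le_trans b0 _; have := oag_leD2l 0 a b a0; rewrite addr0 addrC.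
Qed.

(** Were v x <= 0, the inverse of x would be integral, and multiplying x^n by its n-th power would
    give v 1 > 0. *)
Lemma v_exp_gt0 x n : VFin 0 < v (x ^+ n) -> VFin 0 < v x.
Proof.
apply: contraTT; rewrite -!leNgt -(v_one v) => x1.
have x0 : x != 0 by rewrite -(v_lt_inf x) (le_lt_trans x1) // v_one.
have xV : x^-1 ^+ n \in vring v by rewrite rpredX // inE -[x^-1]mul1r v_le_div.
rewrite leNgt v_one; apply/negP => /(v_maxM xV).
by rewrite exprVn mulVf ?expf_neq0 // v_one ltxx.
Qed.

Lemma v_lt_exp x y n : (0 < n)%N -> v (x ^+ n) < v (y ^+ n) -> v x < v y.
Proof.
move=> n0; have [->|x0] := eqVneq x 0.
  by rewrite expr0n gtn_eqF // v_zero ltNge v_le_inf.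
have xX := expf_neq0 n x0.
by rewrite -(v_lt_div _ xX) -exprVn -exprMn => /v_exp_gt0; rewrite v_lt_div.
Qed.

Lemma v_ltE_exp x y n : (0 < n)%N -> v x < v y -> v (x ^+ n) < v (y ^+ n).
Proof.
move=> n0 xy; have x0 : x != 0 by rewrite -(v_lt_inf x) (lt_le_trans xy) // v_le_inf.
move: xy; rewrite -(v_lt_div _ x0) -(v_lt_div _ (expf_neq0 n x0)) -exprVn -exprMn => xy.
case: n n0 => // n _; elim: n => [//|n IH]; rewrite exprS.
by apply: v_maxM => //; apply: ltW.
Qed.

(* A residue map on the whole field, with value 0 off the valuation ring. *)
Definition red x : resfield v := respi (insubd (0 : vring_type v) x).

Lemma red_insub x : x \in vring v -> val (insubd (0 : vring_type v) x) = x.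
Proof. exact: insubdK. Qed.

Lemma red_val (x : vring_type v) : red (val x) = respi x.
Proof. by rewrite /red valKd. Qed.

Lemma red_eq0 x : x \in vring v -> (red x == 0) = (VFin 0 < v x).
Proof. by move=> xO; rewrite /red respi_eq0 inE red_insub. Qed.

Lemma redB x y : x \in vring v -> y \in vring v -> red (x - y) = red x - red y.
Proof.
move=> xO yO; rewrite /red /respi -rmorphB -!/(respi _).
congr respi; apply: val_inj.
by rewrite red_insub ?rpredB // rmorphB /= !insubdK.
Qed.

Lemma redM x y : x \in vring v -> y \in vring v -> red (x * y) = red x * red y.
Proof.
move=> xO yO; rewrite /red -respiM; congr respi; apply: val_inj.
by rewrite red_insub ?rpredM // rmorphM /= !insubdK.
Qed.

Lemma red_sum (I : Type) (r : seq I) (f : I -> F) : (forall i, f i \in vring v) ->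
  red (\sum_(i <- r) f i) = \sum_(i <- r) red (f i).
Proof.
move=> fO; have red0 : red 0 = 0 by apply/eqP; rewrite red_eq0 ?rpred0 // v_zero.
elim: r => [|i r IH]; first by rewrite !big_nil.
have rO : \sum_(i <- r) f i \in vring v by rewrite rpred_sum.
rewrite !big_cons -IH -[X in red (_ + X)]opprK redB ?rpredN //.
by rewrite -[in red (- _)]sub0r redB ?rpred0 // red0 sub0r opprK.
Qed.

Lemma residue_set_red (E : set F) x : E x -> x \in vring v -> @residue_set _ _ v E (red x).
Proof.
by move=> Ex xO; exists (insubd (0 : vring_type v) x); rewrite //= red_insub.
Qed.

Lemma residue_setP (E : set F) r :
  @residue_set _ _ v E r -> exists x, [/\ E x, x \in vring v & red x = r].
Proof.
by move=> [x Ex <-]; exists (val x); split; [|exact: valP|exact: red_val].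
Qed.

Lemma red1 : red 1 = 1.
Proof. by rewrite -respi1 -red_val; congr red. Qed.

End Valuation.

(** * Minimal polynomials and lifting of homomorphisms *)

(** Take an annihilating polynomial of least size: the remainder of any other is smaller, hence
    zero. The embedding j allows for K and for the domain of a partial homomorphism. *)
Lemma minpoly_exists (F M : fieldType) (j : {rmorphism F -> M}) (z : M) :
  algebraicOver j z ->
  exists f : {poly F}, [/\ f \is monic, root (map_poly j f) z &
    forall q, root (map_poly j q) z -> f %| q].
Proof.
move=> [q0 q0n0 q0z].
pose P n := `[<exists q : {poly F}, [/\ q != 0, root (map_poly j q) z & size q = n]>].
have exP : exists n, P n by exists (size q0); apply/asboolP; exists q0.
have [_ /asboolP[f [f0 fz <-]] fmin] := ex_minnP exP.
have lf0 : lead_coef f != 0 by rewrite lead_coef_eq0.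
have ass : f %= (lead_coef f)^-1 *: f by rewrite eqp_sym eqp_scale // invr_eq0.
exists ((lead_coef f)^-1 *: f); split.
- by rewrite monicE lead_coefZ mulVf.
- by rewrite map_polyZ rootZ // fmorph_eq0 invr_eq0.
move=> q qz; rewrite -(eqp_dvdl _ ass); apply: contraT => nd.
have r0 : q %% f != 0 by [].
have := fmin (size (q %% f)); rewrite leqNgt ltn_modp f0; apply.
apply/asboolP; exists (q %% f); split=> //.
have -> : q %% f = q - q %/ f * f by rewrite {2}(divp_eq q f) addrAC subrr add0r.
by rewrite rmorphB rmorphM /root !hornerE (rootP qz) (rootP fz) mulr0 subr0.
Qed.

(** Write the minimal polynomial as g X + e. Minimality makes e nonzero, and g(u) u = -e. *)
Lemma alg_inverse (F M : fieldType) (j : {rmorphism F -> M}) (u : M) :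
  u != 0 -> algebraicOver j u -> exists g : {poly F}, u^-1 = (map_poly j g).[u].
Proof.
move=> u0 /minpoly_exists[f [fm fu fmin]].
have [[g e] fE] : exists ge : {poly F} * F, f = ge.1 * 'X + ge.2%:P.
  by elim/poly_ind: f {fm fu fmin} => [|g e _]; [exists (0, 0)|exists (g, e)];
     rewrite ?mul0r ?addr0.
have e0 : e != 0.
  apply: contraTneq (fu) => e0; apply/negP => _.
  have g0 : g != 0.
    apply: contraTneq fm => g0.
    by rewrite fE e0 g0 mul0r addr0 monicE lead_coef0 eq_sym oner_eq0.
  have : root (map_poly j g) u.
    move: fu; rewrite fE e0 /= addr0 rmorphM /= map_polyX rootM => /orP[//|].
    by rewrite rootX (negPf u0).
  move/fmin/dvdp_leq => /(_ g0); rewrite fE e0 /= addr0 size_mulX //.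
  by rewrite ltnn.
exists (- e^-1 *: g); apply: (mulIf u0); rewrite mulVf //.
have := rootP fu; rewrite fE /= rmorphD rmorphM /= map_polyX map_polyC /= !hornerE.
move=> /eqP; rewrite addr_eq0 => /eqP gu.
by rewrite map_polyZ hornerZ -mulrA gu rmorphN mulrNN -rmorphM mulVf // rmorph1.
Qed.

(** * Extension of homomorphisms by Zorn's lemma *)

Section PartialHom.
Variables (K : fieldType) (M : closedFieldType) (j : {rmorphism K -> M}).
(** The graph of a homomorphism over K from a subring of M to M. By closure under differences, the
    last clause is single-valuedness. Graphs suit Zorn's lemma, as chains are bounded by their
    unions. *)
Definition is_partial_hom (S : set (M * M)) :=
  [/\ forall k, S (j k, j k),
      forall p q, S p -> S q -> S (p - q),
      forall p q, S p -> S q -> S (p * q) &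
      forall y, S (0, y) -> y = 0].

(* The algebraicity of M is recorded here because it is what makes a partial
   homomorphism a field. *)
Record partial_hom := PartialHom {
  ph_set :> set (M * M);
  ph_alg : forall x, algebraicOver j x;
  ph_setP : is_partial_hom ph_set
}.

Section Field.
Variable S : partial_hom.

Definition ph_pred : {pred M * M} := fun p => `[<ph_set S p>].

Fact ph_subring : subring_closed ph_pred.
Proof.
have [S1 SB SM _] := ph_setP S.
split=> [|p q /asboolP Sp /asboolP Sq|p q /asboolP Sp /asboolP Sq]; apply/asboolP.
- by have := S1 1; rewrite rmorph1.
- exact: SB.
- exact: SM.
Qed.
HB.instance Definition _ := GRing.isSubringClosed.Build _ ph_pred ph_subring.

(** The graph itself serves as the domain: [ph_fst] is its inclusion in M and [ph_snd] the
    homomorphism. *)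
Record ph_type := PH { ph_val :> M * M; ph_valP : ph_val \in ph_pred }.
HB.instance Definition _ := [isSub for ph_val].
HB.instance Definition _ := [Choice of ph_type by <:].
HB.instance Definition _ := [SubChoice_isSubComNzRing of ph_type by <:].

Definition ph_fst (b : ph_type) : M := (val b).1.
Definition ph_snd (b : ph_type) : M := (val b).2.

Fact ph_fst_zmod : zmod_morphism ph_fst. Proof. by []. Qed.
Fact ph_fst_monoid : monoid_morphism ph_fst. Proof. by []. Qed.
Fact ph_snd_zmod : zmod_morphism ph_snd. Proof. by []. Qed.
Fact ph_snd_monoid : monoid_morphism ph_snd. Proof. by []. Qed.
HB.instance Definition _ := GRing.isZmodMorphism.Build _ _ ph_fst ph_fst_zmod.
HB.instance Definition _ := GRing.isMonoidMorphism.Build _ _ ph_fst ph_fst_monoid.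
HB.instance Definition _ := GRing.isZmodMorphism.Build _ _ ph_snd ph_snd_zmod.
HB.instance Definition _ := GRing.isMonoidMorphism.Build _ _ ph_snd ph_snd_monoid.

Lemma ph_mem (b : ph_type) : ph_set S (ph_fst b, ph_snd b).
Proof. by case: b => -[u w] Sb; apply/asboolP. Qed.

Lemma ph_of u w : ph_set S (u, w) -> exists b, ph_fst b = u /\ ph_snd b = w.
Proof. by move=> /asboolP Suw; exists (PH Suw). Qed.

Lemma ph_fst_eq0 (b : ph_type) : ph_fst b = 0 -> b = 0.
Proof.
have [_ _ _ S0] := ph_setP S.
move=> b0; apply: val_inj; move: (ph_mem b) b0.
rewrite /ph_fst /ph_snd /=; case: (val b) => u w /= Suw u0.
by move: Suw; rewrite u0 => /S0 ->.
Qed.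

Fact ph_const_subproof k : (j k, j k) \in ph_pred.
Proof. by apply/asboolP; have [] := ph_setP S. Qed.
Definition ph_const k : ph_type := PH (ph_const_subproof k).

Fact ph_const_zmod : zmod_morphism ph_const.
Proof. by move=> x y; apply: val_inj; rewrite /= rmorphB. Qed.
Fact ph_const_monoid : monoid_morphism ph_const.
Proof. by split=> [|x y]; apply: val_inj; rewrite /= (rmorph1, rmorphM). Qed.
HB.instance Definition _ := GRing.isZmodMorphism.Build _ _ ph_const ph_const_zmod.
HB.instance Definition _ := GRing.isMonoidMorphism.Build _ _ ph_const ph_const_monoid.

(** The inverse of [ph_fst b] is a polynomial in it over K; the same polynomial in b stays inside
    the graph. *)
Lemma ph_inverse (b : ph_type) : b != 0 -> exists c, c * b = 1.
Proof.
move=> b0; have u0 : ph_fst b != 0 by apply: contra_neq b0; exact: ph_fst_eq0.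
have [g gE] := alg_inverse u0 (ph_alg S (ph_fst b)).
exists (map_poly ph_const g).[b].
apply/eqP; rewrite -subr_eq0; apply/eqP/ph_fst_eq0.
rewrite rmorphB rmorphM rmorph1 /= -horner_map -map_poly_comp -[map_poly _ _]/(map_poly j g).
by rewrite -gE mulVf // subrr.
Qed.

Definition ph_inv (b : ph_type) : ph_type :=
  if pselect (b != 0) is left b0 then projT1 (cid (ph_inverse b0)) else 0.

Fact ph_mulVf b : b != 0 -> ph_inv b * b = 1.
Proof. by rewrite /ph_inv; case: pselect => // b0 _; case: cid. Qed.
Fact ph_inv0 : ph_inv 0 = 0.
Proof. by rewrite /ph_inv; case: pselect => // n0; case/eqP: (n0). Qed.
HB.instance Definition _ := GRing.ComNzRing_isField.Build ph_type ph_mulVf ph_inv0.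

(** The extension sends g(x) to the image of g at x'. It is single-valued because a g vanishing at x
    is a multiple of f. *)
Lemma ph_extend x x' (f : {poly ph_type}) :
  (forall q, root (map_poly ph_fst q) x -> f %| q) ->
  root (map_poly ph_snd f) x' ->
  exists T : partial_hom, S `<=` T /\ ph_set T (x, x').
Proof.
move=> fmin fx'.
pose T : set (M * M) := [set ((map_poly ph_fst g).[x], (map_poly ph_snd g).[x'])
  | g in [set: {poly ph_type}]].
have ST : S `<=` T.
  move=> [u w] /ph_of[b [<- <-]]; exists b%:P => //.
  by rewrite !map_polyC !hornerC.
have TP : is_partial_hom T.
  split=> [k|_ _ [g _ <-] [h _ <-]|_ _ [g _ <-] [h _ <-]|y [g _ [gx <-]]].
  - by apply: ST; have [] := ph_setP S.
  - by exists (g - h) => //; rewrite !rmorphB !hornerE.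
  - by exists (g * h) => //; rewrite !rmorphM !hornerE.
  have /fmin/dvdpP[q ->] : root (map_poly ph_fst g) x by apply/rootP.
  by rewrite rmorphM hornerE (rootP fx') mulr0.
exists (PartialHom (ph_alg S) TP); split=> //=; exists 'X => //.
by rewrite !map_polyX !hornerX.
Qed.

End Field.

Lemma ph_extendT (S : partial_hom) x : exists T : partial_hom, S `<=` T /\ exists y, ph_set T (x, y).
Proof.
have ax : algebraicOver (@ph_fst S) x.
  have [q q0 qx] := ph_alg S x; exists (map_poly (@ph_const S) q).
    by rewrite map_poly_eq0.
  by rewrite -map_poly_comp.
have [f [fm fx fmin]] := minpoly_exists ax.
(* Both projections preserve sizes, so the image of f is nonconstant like f and has a root in M. *)
have sf : size (map_poly (@ph_snd S) f) != 1.
  rewrite size_map_poly -(size_map_poly (@ph_fst S)).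
  by apply: contraTneq fx => /eqP /size_poly1P[c c0 ->]; rewrite rootC.
have /closed_rootP[x' fx'] := sf.
by have [T [ST Txx']] := ph_extend fmin fx'; exists T; split=> //; exists x'.
Qed.

Lemma ph_total (S : partial_hom) :
  exists s : {rmorphism M -> M}, forall u w, ph_set S (u, w) -> s u = w.
Proof.
(* Stating the property for the union with S covers the empty chain. *)
have chain (F : set (set (M * M))) : F `<=` (fun X => is_partial_hom (X `|` S)) ->
    total_on F subset -> is_partial_hom ((\bigcup_(X in F) X) `|` S).
  move=> FP Ftot; set U := \bigcup_(X in F) X.
  have [S1 SB SM S0] := ph_setP S.
  have two p q : (U `|` S) p -> (U `|` S) q -> exists X : set (M * M),
     [/\ is_partial_hom (X `|` S), X `<=` U, (X `|` S) p & (X `|` S) q].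
    move=> [[X FX Xp]|Sp] [[Y FY Yq]|Sq].
    - have [XY|YX] := Ftot X Y FX FY.
        exists Y; split; [exact: FP|by move=> z Yz; exists Y| |by left].
        by left; apply: XY.
      exists X; split; [exact: FP|by move=> z Yz; exists X|by left|].
      by left; apply: YX.
    - by exists X; split; [exact: FP|by move=> z Yz; exists X|left|right].
    - by exists Y; split; [exact: FP|by move=> z Yz; exists Y|right|left].
    - by exists set0; split; [rewrite set0U; exact: ph_setP| |right|right].
  split=> [k|p q Up Uq|p q Up Uq|y Uy].
  - by right.
  - have [X [[_ XB _ _] XU Xp Xq]] := two p q Up Uq.
    by apply: (subset_trans (setSU XU)) (XB _ _ Xp Xq).
  - have [X [[_ _ XM _] XU Xp Xq]] := two p q Up Uq.
    by apply: (subset_trans (setSU XU)) (XM _ _ Xp Xq).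
  - by have [X [[_ _ _ X0] XU Xy _]] := two _ _ Uy Uy; exact: X0.
have [X [XP Xmax]] := Zorn_bigcup chain.
pose T := PartialHom (ph_alg S) XP.
have Ttot x : exists y, ph_set T (x, y).
  have [T' [TT' [y Txy]]] := ph_extendT T x.
  exists y; left; apply: contrapT => nXy; apply: (Xmax T').
    by split; [move=> p Xp; apply: TT'; left|move=> /(_ (x, y) Txy)].
  rewrite (_ : T' `|` S = T'); first exact: ph_setP.
  by apply/setUidPl => p Sp; apply: TT'; right.
have [s sP] := choice Ttot.
have [T1 TB TM T0] := ph_setP T.
have Tfun u w w' : ph_set T (u, w) -> ph_set T (u, w') -> w = w'.
  move=> Tw Tw'; have : ph_set T (0, w - w') by have := TB _ _ Tw Tw'; rewrite /= -[_ - _]/(u - u, w - w') subrr.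
  by move/T0/eqP; rewrite subr_eq0 => /eqP.
have sB : zmod_morphism s.
  by move=> u w; apply: Tfun (sP _) _; exact: (TB _ _ (sP u) (sP w)).
have sM : monoid_morphism s.
  split=> [|u w]; last by apply: Tfun (sP _) _; exact: (TM _ _ (sP u) (sP w)).
  by apply: Tfun (sP _) _; have := T1 1; rewrite rmorph1.
pose s1 := GRing.isZmodMorphism.Build _ _ s sB.
pose s2 := GRing.isMonoidMorphism.Build _ _ s sM.
exists (HB.pack s s1 s2 : {rmorphism M -> M}) => u w Suw /=.
by apply: Tfun (sP u) _; right.
Qed.

(** An injective map over K permutes the finitely many roots of a polynomial over K, and every y is
    such a root. *)
Lemma alg_inj_surj (s : {rmorphism M -> M}) :
  (forall x, algebraicOver j x) -> (forall k, s (j k) = j k) -> bijective s.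
Proof.
move=> algM sj; have sinj : injective s by exact: fmorph_inj.
have surj y : exists x, s x = y.
  have [q q0 qy] := algM y.
  have q0' : map_poly j q != 0 by rewrite map_poly_eq0.
  have sr z : root (map_poly j q) z -> root (map_poly j q) (s z).
    move=> /rootP qz; apply/rootP; rewrite -[map_poly j q](_ : map_poly s (map_poly j q) = _).
      by rewrite horner_map qz rmorph0.
    by rewrite -map_poly_comp; apply: eq_map_poly.
  have [rs rsE] := closed_field_poly_normal (map_poly j q).
  have lq0 : lead_coef (map_poly j q) != 0 by rewrite lead_coef_eq0.
  have mem z : (z \in undup rs) = root (map_poly j q) z.
    by rewrite mem_undup rsE rootZ // root_prod_XsubC.
  have sub : {subset map s (undup rs) <= undup rs}.
    by move=> _ /mapP[z zr ->]; rewrite mem sr // -mem.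
  have um : uniq (map s (undup rs)) by rewrite map_inj_uniq ?undup_uniq.
  have [|_ eqm] := uniq_min_size um sub; first by rewrite size_map.
  by have := eqm y; rewrite mem qy => /mapP[z _ ->]; exists z.
have [t tP] := choice surj.
by exists t => // x; apply: sinj.
Qed.

End PartialHom.

(** * Lifting to the absolute ramification group *)

Section Scaling.
Variables (n : nat) (R : comNzRingType) (M : fieldType) (f : {rmorphism R -> M}).
Variable y : 'I_n -> M.

Lemma mcoeff_mmap_scale (p : {mpoly R[n]}) (m : 'X_{1.. n}) :
  (mmap (@mpolyC n M \o f) (fun i => y i *: 'X_i) p)@_m
    = f p@_m * \prod_(i < n) y i ^+ m i.
Proof.
have mmapm m' : mmap1 (fun i => y i *: 'X_i : {mpoly M[n]}) m' =
    (\prod_(i < n) y i ^+ m' i) *: 'X_[m'].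
  rewrite mpolyXE_id -scaler_prod; apply: eq_bigr => i _.
  by rewrite exprZn.
rewrite /mmap raddf_sum /=.
under eq_bigr => m' _ do rewrite mmapm mul_mpolyC !mcoeffZ mcoeffX mulrA.
have [mp|mp] := boolP (m \in msupp p).
  rewrite (bigD1_seq m) ?msupp_uniq //= eqxx mulr1 [X in _ + X]big1 ?addr0 // => m' /negPf ->.
  by rewrite mulr0.
rewrite big_seq big1 ?(memN_msupp_eq0 mp) ?rmorph0 ?mul0r // => m' m'p.
by case: eqP m'p mp => [-> ->|_]; rewrite ?mulr0.
Qed.

End Scaling.

(* A point whose coordinates sum to zero but are otherwise independent separates
   the linear form with all coefficients 1. *)
Lemma prod_linear_forms (n : nat) (R : comNzRingType) (k : fieldType)
    (pr : {rmorphism R -> k}) (I : eqType) (t : seq I) (A B : I -> 'I_n.+1 -> R) a :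
  (forall m, pr (\prod_(u <- t) \sum_(i < n.+1) B u i *: 'X_i : {mpoly R[n.+1]})@_m =
             pr (\prod_(u <- t) \sum_(i < n.+1) A u i *: 'X_i : {mpoly R[n.+1]})@_m) ->
  a \in t -> (forall i, pr (A a i) = 1) -> (forall u, u \in t -> pr (B u ord0) = 1) ->
  exists2 u, u \in t & forall i, pr (B u i) = 1.
Proof.
move=> AB at_ Aa B0.
(* Powers of an indeterminate are independent even over a finite k; the coordinate at 0 makes the
   sum vanish. *)
pose th (i : 'I_n.+1) : {poly k} :=
  if i == ord0 then - \sum_(l < n) 'X^(l.+1) else 'X^i.
have thS : \sum_i th i = 0.
  rewrite big_ord_recl {1}/th eqxx -sumrN -big_split big1 //= => l _.
  by rewrite /th eq_sym (negPf (neq_lift _ _)) addNr.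
pose Th := mmap (polyC \o pr) th.
have ThP (C : I -> 'I_n.+1 -> R) :
    Th (\prod_(u <- t) \sum_(i < n.+1) C u i *: 'X_i) =
    \prod_(u <- t) \sum_(i < n.+1) (pr (C u i))%:P * th i.
  rewrite /Th rmorph_prod; apply: eq_bigr => u _.
  rewrite raddf_sum; apply: eq_bigr => i _.
  by rewrite [LHS]mmapZ mmapX mmap1U.
have : Th (\prod_(u <- t) \sum_(i < n.+1) B u i *: 'X_i) = 0.
  transitivity (Th (\prod_(u <- t) \sum_(i < n.+1) A u i *: 'X_i)).
    apply/eqP; rewrite -subr_eq0 -rmorphB; apply/eqP; apply: big1 => m _.
    by rewrite mcoeffB /= rmorphB AB subrr mul0r.
  rewrite ThP (big_rem _ at_) /= (_ : \sum_i _ = 0) ?mul0r //.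
  by rewrite -[RHS]thS; apply: eq_bigr => i _; rewrite Aa mul1r.
(* As k[X] is a domain, some factor vanishes here. Its coefficient at X^(l+1) is the difference
   between a coefficient of the form and 1. *)
rewrite ThP => /eqP; rewrite prodf_seq_eq0 => /hasP[u ut /= /eqP thu].
exists u => // i; have [->|i_neq0] := eqVneq i ord0; first exact: B0.
have [l iE] : exists l, i = lift ord0 l.
  by case: (unliftP ord0 i) => [l|] iE; [exists l|rewrite iE eqxx in i_neq0].
move: thu; rewrite big_ord_recl B0 // mul1r {1}/th eqxx addrC -sumrB.
move=> /(congr1 (coefp l.+1)); rewrite /coefp coef0 coef_sum (bigD1 l) //=.
rewrite big1 => [|m ml]; last first.
  rewrite coefB coefCM /th eq_sym (negPf (neq_lift _ _)) !coefXn.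
  by rewrite lift0 eqSS eq_sym (inj_eq val_inj) (negPf ml) mulr0 subr0.
rewrite addr0 coefB coefCM /th eq_sym (negPf (neq_lift _ _)) !coefXn lift0 eqxx.
by rewrite mulr1 -iE => /eqP; rewrite subr_eq0 => /eqP.
Qed.

(* Compactness of a product of finite sets, by means of an ultrafilter. *)
Lemma compact_choice (T : eqType) (W : set (T -> T)) (b : T -> seq T)
    (Q : T -> T -> Prop) :
  (forall w x, W w -> w x \in b x) ->
  (forall ys : seq T, exists2 w, W w & forall y, y \in ys -> Q y (w y)) ->
  exists f : T -> T, forall ys : seq T,
    exists2 w, W w & forall y, y \in ys -> f y = w y /\ Q y (w y).
Proof.
move=> Wb finQ.
(* A set is large if it contains all w in W satisfying Q at finitely many given points. An
   ultrafilter refining this selects one value at each x, since [b x] is finite. *)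
pose F : set_system (T -> T) := [set A | exists ys : seq T,
  forall w, W w -> (forall y, y \in ys -> Q y (w y)) -> A w].
have FF : ProperFilter F.
  apply: Build_ProperFilter_ex => [A [ys ysA]|].
    by have [w Ww wQ] := finQ ys; exists w; apply: ysA.
  split=> [|A A' [ys ysA] [ys' ysA']|A A' AA' [ys ysA]].
  - by exists [::].
  - exists (ys ++ ys') => w Ww wQ; split; [apply: ysA|apply: ysA'] => // y yy;
      by apply: wQ; rewrite mem_cat yy ?orbT.
  - by exists ys => w Ww wQ; apply/AA'/ysA.
have [U [UU FU]] := ultraFilterLemma FF.
have UQ x : U [set w | W w /\ Q x (w x)].
  by apply: FU; exists [:: x] => w Ww wQ; split=> //; apply: wQ; rewrite inE.
have lim x : exists y, U [set w | w x = y].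
  have : U [set w | w x \in b x] by apply: FU; exists [::] => w Ww _; apply: Wb.
  elim: (b x) => [|y s IH] Us.
    by have [w] := @filter_ex _ U _ _ Us.
  have [Uy|Uy] := in_ultra_setVsetC [set w | w x = y] UU; first by exists y.
  apply: IH; apply: filterS (filterI Us Uy) => w [/=].
  by rewrite inE => /orP[/eqP|].
have [f fP] := choice lim; exists f => ys.
have : U [set w | W w /\ forall y, y \in ys -> f y = w y /\ Q y (w y)].
  elim: ys => [|y ys IH].
    by apply: FU; exists [::] => w Ww _; split.
  apply: filterS (filterI (filterI IH (fP y)) (UQ y)) => w [[[Ww wys] wy] [_ Qy]].
  split=> // z; rewrite inE => /orP[/eqP ->|/wys //]; split=> //; exact/esym.
by move=> /(@filter_ex _ U _ _)[w [Ww wys]]; exists w.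
Qed.

Section RamificationLifting.
Variables (K E : fieldType) (M : closedFieldType) (G : oagType).
Variables (v : valuation M G) (i0 : {rmorphism K -> E}) (iota : {rmorphism E -> M}).
Let j : {rmorphism K -> M} := iota \o i0.
Hypothesis algM : forall x, algebraicOver j x.
Hypothesis v_aut : forall s : {rmorphism M -> M},
  (forall k, s (j k) = j k) -> forall x, v (s x) = v x.

Lemma lift_endomorphism (s : {rmorphism E -> E}) : (forall k, s (i0 k) = i0 k) ->
  exists t : {rmorphism M -> M}, forall e, t (iota e) = iota (s e).
Proof.
move=> sK; pose S : set (M * M) := range (fun e => (iota e, iota (s e))).
have SP : is_partial_hom j S.
  split=> [k|_ _ [e _ <-] [e' _ <-]|_ _ [e _ <-] [e' _ <-]|y [e _ [/eqP]]].
  - by exists (i0 k) => //; rewrite sK.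
  - by exists (e - e') => //; rewrite !rmorphB.
  - by exists (e * e') => //; rewrite !rmorphM.
  - by rewrite fmorph_eq0 => /eqP ->; rewrite !rmorph0.
have [t tP] := ph_total (PartialHom algM SP).
by exists t => e; apply: tP; exists e.
Qed.

Variable s : {rmorphism M -> M}.
Hypothesis sK : forall k, s (j k) = j k.
Hypothesis s_ram : forall e, e != 0 -> v (iota e) < v (s (iota e) - iota e).

Definition fixes (h : {rmorphism M -> M}) := forall e, h (iota e) = iota e.

Lemma fixes_v h x : fixes h -> v (h x) = v x.
Proof. by move=> hE; apply: v_aut => k; apply: hE. Qed.

(* All conjugates of c over E being equal to c, its minimal polynomial is
   (X - c)^m. Its coefficients hardly move under s, and evaluating its image
   under s at c bounds (c - s c)^m. *)
Lemma fixed_ram c : c != 0 -> (forall h, fixes h -> h c = c) -> v c < v (s c - c).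
Proof.
move=> c0 cfix.
pose D : set (M * M) := range (fun e => (iota e, iota e)).
have DP : is_partial_hom j D.
  split=> [k|_ _ [e _ <-] [e' _ <-]|_ _ [e _ <-] [e' _ <-]|y [e _ [-> ->]]] //.
  - by exists (i0 k).
  - by exists (e - e') => //; rewrite !rmorphB.
  - by exists (e * e') => //; rewrite !rmorphM.
pose S := PartialHom algM DP.
have fstD (b : ph_type S) : exists2 e, ph_fst b = iota e & ph_snd b = iota e.
  by have [e _ [<- <-]] := ph_mem b; exists e.
have ac : algebraicOver (@ph_fst _ _ _ S) c.
  have [q q0 qx] := algM c; exists (map_poly (@ph_const _ _ _ S) q).
    by rewrite map_poly_eq0.
  by rewrite -map_poly_comp.
have [f [fm fc fmin]] := minpoly_exists ac.
have fsE : map_poly (@ph_snd _ _ _ S) f = map_poly (@ph_fst _ _ _ S) f.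
  by apply: eq_map_poly => b; have [e -> ->] := fstD b.
pose g := map_poly (@ph_fst _ _ _ S) f.
have roots z : root g z -> z = c.
  rewrite /g -fsE => gz.
  have [T [ST Tcz]] := ph_extend fmin gz.
  have [h hP] := ph_total T.
  by rewrite -(hP c z Tcz) cfix // => e; apply: hP; apply: ST; exists e.
have [m gE] : exists m, g = ('X - c%:P) ^+ m.
  have [rs] := closed_field_poly_normal g.
  rewrite (monicP _) ?monic_map // scale1r => gE.
  exists (size rs); rewrite gE (eq_big_seq (fun=> 'X - c%:P)).
    by rewrite big_const_seq count_predT iter_mulr_1.
  by move=> z zr; rewrite (roots z) // gE root_prod_XsubC.
(* Substituting c X for X turns (X - c)^m into c^m (X - 1)^m, and (X - 1)^m has integral
   coefficients. *)
have coefc i : v (c ^+ m) <= v (g`_i * c ^+ i).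
  have -> : g`_i * c ^+ i = c ^+ m * (('X - 1%:P) ^+ m)`_i.
    have -> : g`_i * c ^+ i = (g \Po (c *: 'X))`_i.
      rewrite comp_polyE coef_sum.
      under eq_bigr => k _ do rewrite exprZn coefZ coefZ coefXn.
      have [ig|ig] := ltnP i (size g).
        rewrite (bigD1 (Ordinal ig)) //= eqxx mulr1 big1 ?addr0 // => k kn.
        by rewrite (_ : i == k = false) ?mulr0 //; apply: contraNF kn => /eqP ik; apply/eqP/val_inj.
      rewrite nth_default // mul0r big1 // => k _.
      by rewrite gtn_eqF ?mulr0 // (leq_trans _ ig).
    rewrite gE rmorphXn /= rmorphB /= comp_polyX comp_polyC.
    have -> : c *: 'X - c%:P = c *: ('X - 1%:P) :> {poly M}.
      by rewrite scalerBr -mul_polyC -mul_polyC -polyCM mulr1.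
    by rewrite exprZn coefZ.
  rewrite -{1}[c ^+ m]mulr1 v_le_mul2l ?expf_neq0 // v_one.
  have /polyOverP/(_ i) : ('X - 1%:P : {poly M}) ^+ m \is a polyOver (vring v).
    by rewrite rpredX // rpredB ?polyOverX // polyOverC rpred1.
  by [].
have m0 : (0 < m)%N.
  by move: fc; rewrite -/g gE; case: (m) => //; rewrite expr0 rootC oner_eq0.
have sgc : (c - s c) ^+ m = \sum_(i < size g) (s g`_i - g`_i) * c ^+ i.
  have -> : (c - s c) ^+ m = (map_poly s g).[c].
    by rewrite gE rmorphXn /= rmorphB /= map_polyX map_polyC /= horner_exp !hornerE.
  rewrite -[LHS]subr0 -[X in _ - X](rootP fc) -/g !horner_coef size_map_poly -sumrB.
  by apply: eq_bigr => i _; rewrite coef_map mulrBl.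
apply: (@v_lt_exp _ _ v _ _ m) => //.
rewrite -[X in _ < v X](opprK) v_opp.
have -> : v (- (s c - c) ^+ m) = v ((c - s c) ^+ m).
  by rewrite v_opp; apply: v_expE; rewrite v_sub_sym.
have [gm vgm] := v_fin v (expf_neq0 m c0).
rewrite sgc vgm; apply: v_gt_sum => i _.
have [e gi _] := fstD f`_i; rewrite /g coef_map /= gi.
have [->|e0] := eqVneq e 0; first by rewrite !rmorph0 subrr mul0r v_zero.
apply: le_lt_trans (_ : v (iota e * c ^+ i) < _).
  by rewrite -vgm -gi -coef_map.
by rewrite mulrC [X in _ < v X]mulrC v_lt_mul2l ?expf_neq0 // s_ram.
Qed.

(** Each entry has finitely many conjugates. Whole tuples are listed, so that a member of t comes
    from one h common to all entries. *)
Lemma orbit_seq (ys : seq M) : exists t : seq (seq M),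
  uniq t /\ forall u, (u \in t) = `[<exists2 h, fixes h & u = map h ys>].
Proof.
have [t0 t0P] : exists t0 : seq (seq M), forall h, fixes h -> map h ys \in t0.
  elim: ys => [|y ys [t0 t0P]]; first by exists [:: [::]].
  have [q q0 qy] := algM y.
  have [rs rsE] := closed_field_poly_normal (map_poly j q).
  exists [seq z :: u | z <- rs, u <- t0] => h hE.
  apply: allpairs_f; last exact: t0P.
  have qh : root (map_poly j q) (h y).
    have -> : map_poly j q = map_poly h (map_poly j q).
      by rewrite -map_poly_comp; apply: eq_map_poly => k /=; rewrite hE.
    by rewrite /root horner_map (rootP qy) rmorph0.
  move: qh; rewrite rsE rootZ ?root_prod_XsubC //.
  by rewrite lead_coef_eq0 map_poly_eq0.
exists (undup [seq u <- t0 | `[<exists2 h, fixes h & u = map h ys>]]).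
split=> [|u]; first exact: undup_uniq.
rewrite mem_undup mem_filter andb_idr // => /asboolP[h hE ->].
exact: t0P.
Qed.

(* The product over all conjugates u of ys of the linear forms sum_i u_i X_i has
   coefficients fixed by the automorphisms over E. After rescaling X_i by the
   inverse of y_i it therefore has the same reduction as its image under s. The
   reduction of the former has a factor vanishing at any point the sum of whose
   coordinates is zero, hence so has the latter. *)
Lemma finite_ram_lift (ys : seq M) : (forall y, y \in ys -> y != 0) ->
  exists2 h, fixes h & forall y, y \in ys -> v y < v (s (h y) - y).
Proof.
(* The entry 1 is fixed by every h, which provides the coefficient 1 at [ord0] required by
   [prod_linear_forms]. *)
wlog : ys / exists zs, ys = 1 :: zs.
  move=> H ysn; have [|y|h hE hys] := H (1 :: ys); first by exists ys.
    by rewrite inE => /orP[/eqP ->|/ysn]; rewrite ?oner_eq0.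
  by exists h => // y yys; apply: hys; rewrite inE yys orbT.
move=> [zs ysE] ysn; have [t [tu tP]] := orbit_seq ys.
have yst : ys \in t.
  by rewrite tP; apply/asboolP; exists idfun; [move=> e|exact/esym/map_id].
set n := size zs; have sys : size ys = n.+1 by rewrite ysE.
pose y (i : 'I_n.+1) := ys`_i.
have y0 i : y i != 0 by apply: ysn; apply: mem_nth; rewrite sys.
have tsize u : u \in t -> size u = n.+1.
  by rewrite tP => /asboolP[h _ ->]; rewrite size_map.
have tv u (i : 'I_n.+1) : u \in t -> v u`_i = v (y i).
  by rewrite tP => /asboolP[h hE ->]; rewrite (nth_map 0) ?sys // fixes_v.
have tmap h : fixes h -> perm_eq (map (map h) t) t.
  move=> hE; have um : uniq (map (map h) t).
    by rewrite map_inj_uniq // ; apply: inj_map; apply: fmorph_inj.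
  apply: uniq_perm => //; apply: (uniq_min_size um _ _).2; last by rewrite size_map.
  move=> _ /mapP[u + ->]; rewrite !tP => /asboolP[h' h'E ->]; apply/asboolP.
  by exists (h \o h') => [e /=|]; rewrite ?h'E ?hE // -map_comp.
pose P : {mpoly M[n.+1]} := \prod_(u <- t) \sum_(i < n.+1) u`_i *: 'X_i.
have Pmap (h : {rmorphism M -> M}) : map_mpoly h P =
    \prod_(u <- t) \sum_(i < n.+1) h u`_i *: 'X_i.
  rewrite rmorph_prod; apply: eq_bigr => u _; rewrite raddf_sum.
  by apply: eq_bigr => i _; rewrite /= /map_mpoly mmapZ /= mul_mpolyC mmapX mmap1U.
have Pfix h m : fixes h -> h P@_m = P@_m.
  move=> hE; rewrite -mcoeff_map_mpoly; congr mcoeff; rewrite Pmap.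
  rewrite /P -[RHS](perm_big _ (tmap h hE)) /= big_map big_seq [RHS]big_seq.
  apply: eq_bigr => u /tsize su; apply: eq_bigr => i _.
  by rewrite (nth_map 0) ?su //.
pose O := vring_type v.
(* For an isometry f the quotient is integral, as conjugates have equal values, so the default 0
   does not occur. *)
pose A (f : M -> M) (u : seq M) (i : 'I_n.+1) : O := insubd (0 : O) (f u`_i / y i).
pose PO (f : M -> M) : {mpoly O[n.+1]} :=
  \prod_(u <- t) \sum_(i < n.+1) A f u i *: 'X_i.
have AE (f : {rmorphism M -> M}) u i : (forall x, v (f x) = v x) -> u \in t ->
    val (A f u i) * y i = f u`_i.
  move=> vf ut; rewrite /A insubdK ?divfK //.
  by rewrite inE v_le_div // vf tv.
have POE (f : {rmorphism M -> M}) : (forall x, v (f x) = v x) -> forall m,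
    val (PO f)@_m * \prod_(i < n.+1) y i ^+ m i = f P@_m.
  move=> vf m; rewrite -[RHS]mcoeff_map_mpoly Pmap.
  rewrite -(mcoeff_mmap_scale (\val : {rmorphism O -> M})) rmorph_prod big_seq.
  congr (mcoeff m); rewrite [RHS]big_seq; apply: eq_bigr => u ut.
  rewrite raddf_sum; apply: eq_bigr => i _.
  by rewrite [LHS]mmapZ mmapX mmap1U /= mul_mpolyC scalerA AE.
have vs x : v (s x) = v x by apply: v_aut.
(* The coefficients of P are fixed over E, so [fixed_ram] applies to the nonzero ones. *)
have POs m : (PO s)@_m - (PO idfun)@_m \in @vmax _ _ v.
  rewrite inE rmorphB /=.
  have yX : \prod_(i < n.+1) y i ^+ m i != 0.
    by apply/prodf_neq0 => i _; rewrite expf_neq0.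
  have [P0|P0] := eqVneq P@_m 0.
    have z0 (f : {rmorphism M -> M}) : (forall x, v (f x) = v x) -> val (PO f)@_m = 0.
      move=> vf; apply: (mulIf yX); rewrite mul0r POE // P0 rmorph0 //.
    by rewrite !z0 // subrr v_zero.
  rewrite -(v_one v) -(v_lt_mul2l _ _ _ yX) mulr1 mulrBr.
  rewrite [X in _ < v (X - _)]mulrC [X in _ < v (_ - X)]mulrC !POE //=.
  apply: le_lt_trans (fixed_ram P0 (fun h => Pfix h m)).
  have -> : P@_m = idfun P@_m by [].
  rewrite -POE // mulrC -[X in v X <= _]mulr1 v_le_mul2l // v_one.
  by case: ((PO idfun)@_m).
pose pr : {rmorphism O -> resfield v} := \pi_({ideal_quot (@vmax _ _ v)})%qT.
have prB x y' : x - y' \in @vmax _ _ v -> pr x = pr y'.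
  by rewrite -respi_eq0 -[respi _]/(pr _) rmorphB subr_eq0 => /eqP.
have A0 (h : {rmorphism M -> M}) u : u \in t -> A h u ord0 = 1.
  rewrite tP => /asboolP[h' _ ->]; apply: val_inj.
  rewrite /A insubdK /= ?(nth_map 0) ?sys // /y ysE /= !rmorph1 divr1 //.
  by rewrite inE v_one.
have [|||u ut uA] := prod_linear_forms (pr := pr) (A := A idfun) (B := A s) _ yst.
- by move=> m; apply: prB.
- move=> i; rewrite (_ : A _ _ _ = 1) ?rmorph1 //.
  have := y0 i; rewrite /A /y /= => yi; rewrite divff //.
  by apply: val_inj; rewrite insubdK // inE v_one.
- by move=> u ut; rewrite A0 ?rmorph1.
(* The tuple found is the image of ys under a single h, and all the s (h y) / y reduce to 1. *)
move: (ut); rewrite tP => /asboolP[h hE uE]; exists h => //.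
move=> z /(nthP 0)[i]; rewrite sys => ltin <-.
pose i' := Ordinal ltin.
have uE' : val (A s u i') = s (h ys`_i) / ys`_i.
  by apply: (mulIf (y0 i')); rewrite AE // uE (nth_map 0) ?sys // divfK // (y0 i').
rewrite -v_lt_div ?(y0 i') // mulrBl divff ?(y0 i') //.
have : A s u i' - 1 \in @vmax _ _ v.
  by rewrite -respi_eq0 -[respi _]/(pr _) rmorphB rmorph1 uA subrr.
by rewrite inE rmorphB /= uE'.
Qed.

End RamificationLifting.

(** The candidates are one fixed lift of s composed with the homomorphisms over E. Each x has
    finitely many images under them, so the solutions on finite sets can be assembled by
    compactness. *)
Lemma ramification_lift (K E : fieldType) (M : closedFieldType) (G : oagType)
    (v : valuation M G) (i0 : {rmorphism K -> E}) (iota : {rmorphism E -> M})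
    (s : {rmorphism E -> E}) :
  (forall x, algebraicOver (iota \o i0) x) ->
  (forall t : {rmorphism M -> M}, (forall k, t (iota (i0 k)) = iota (i0 k)) ->
    forall x, v (t x) = v x) ->
  (forall k, s (i0 k) = i0 k) ->
  (forall e, e != 0 -> v (iota e) < v (iota (s e) - iota e)) ->
  exists t : {rmorphism M -> M}, [/\ bijective t, forall e, t (iota e) = iota (s e) &
    forall x, x != 0 -> v x < v (t x - x)].
Proof.
move=> algM v_aut sK sram.
have [s' s'E] := lift_endomorphism algM sK.
have s'K k : s' (iota (i0 k)) = iota (i0 k) by rewrite s'E sK.
have s'ram e : e != 0 -> v (iota e) < v (s' (iota e) - iota e).
  by rewrite s'E; apply: sram.
pose W : set (M -> M) := [set w | exists2 h, fixes iota h & w = s' \o h].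
have roots x : exists r : seq M, forall w, W w -> w x \in r.
  have [q q0 qx] := algM x.
  have [rs rsE] := closed_field_poly_normal (map_poly (iota \o i0) q).
  exists rs => _ [h hE ->]; rewrite -root_prod_XsubC.
  have : root (map_poly (iota \o i0) q) ((s' \o h) x).
    have -> : map_poly (iota \o i0) q = map_poly (s' \o h) (map_poly (iota \o i0) q).
      by rewrite -map_poly_comp; apply: eq_map_poly => k /=; rewrite hE s'K.
    by rewrite /root horner_map (rootP qx) rmorph0.
  by rewrite {1}rsE rootZ // lead_coef_eq0 map_poly_eq0.
have [b bP] := choice roots.
have fin (ys : seq M) : exists2 w, W w &
    forall y, y \in ys -> y != 0 -> v y < v (w y - y).
  have [|h hE hys] := finite_ram_lift algM v_aut s'K s'ram (ys := [seq y <- ys | y != 0]).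
    by move=> y; rewrite mem_filter => /andP[].
  exists (s' \o h); first by exists h.
  by move=> y yys y0; apply: hys; rewrite mem_filter /= y0.
have [t tP] := compact_choice
  (Q := fun y z => y != 0 -> v y < v (z - y)) (fun w x => bP x w) fin.
(* Each identity involves finitely many elements, on which t agrees with a single candidate. *)
have tB : zmod_morphism t.
  move=> x y; have [w [h _ ->] tw] := tP [:: x; y; x - y].
  have te z : z \in [:: x; y; x - y] -> t z = s' (h z) by move=> /tw[].
  by rewrite !te ?inE ?eqxx ?orbT // !rmorphB.
have tM : monoid_morphism t.
  split=> [|x y].
    by have [w [h _ ->] tw] := tP [:: 1]; have [|-> _] := tw 1; rewrite ?inE //= !rmorph1.
  have [w [h _ ->] tw] := tP [:: x; y; x * y].
  have te z : z \in [:: x; y; x * y] -> t z = s' (h z) by move=> /tw[].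
  by rewrite !te ?inE ?eqxx ?orbT // !rmorphM.
pose t1 := GRing.isZmodMorphism.Build _ _ t tB.
pose t2 := GRing.isMonoidMorphism.Build _ _ t tM.
pose t' : {rmorphism M -> M} := HB.pack t t1 t2.
have tE e : t (iota e) = iota (s e).
  have [w [h hE ->] tw] := tP [:: iota e]; have [|-> _] := tw (iota e).
    by rewrite inE.
  by rewrite /= hE s'E.
exists t'; split=> //.
- by apply: (alg_inj_surj algM) => k /=; rewrite tE sK.
- by move=> x x0; have [w _ tw] := tP [:: x]; have [|/= -> /(_ x0)] := tw x; rewrite ?inE.
Qed.

(** * Degrees *)

Section Degree.
Variables (K M : fieldType) (j : {rmorphism K -> M}).
Hypothesis algM : forall x, algebraicOver j x.
Let KK : set M := range j.

Lemma subfieldD (F : set M) x y : is_subfield F -> F x -> F y -> F (x + y).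
Proof.
move=> [F1 Fop] Fx Fy; have F0 : F 0 by rewrite -(subrr 1); apply: (Fop 1 1 _ _).1.
have FNy : F (0 - y) by apply: (Fop 0 y _ _).1.
by have := (Fop x (0 - y) Fx FNy).1; rewrite sub0r opprK.
Qed.

Lemma subfieldM (F : set M) x y : is_subfield F -> F x -> F y -> F (x * y).
Proof.
move=> [F1 Fop] Fx Fy; have FVy : F (1 / y) by apply: (Fop 1 y _ _).2.
by have := (Fop x (1 / y) Fx FVy).2; rewrite div1r invrK.
Qed.

(** The ring K[z] is already a field, the inverse of a nonzero element being a polynomial in that
    element. *)
Lemma adjoinE z : adjoin KK z = range (fun q : {poly K} => (map_poly j q).[z]).
Proof.
apply/seteqP; split=> [|_ [q _ <-] F [/= Fsub FKz]].
  apply: smallest_sub => [|_ [[k _ <-]|->]]; last 2 first.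
  - by exists k%:P => //; rewrite map_polyC hornerC.
  - by exists 'X => //; rewrite map_polyX hornerX.
  split=> [|_ _ [p _ <-] [q _ <-]]; first by exists 1 => //; rewrite rmorph1 hornerC.
  split; first by exists (p - q) => //; rewrite rmorphB !hornerE.
  have [q0|q0] := eqVneq (map_poly j q).[z] 0.
    by exists 0 => //; rewrite q0 invr0 mulr0 rmorph0 hornerC.
  have [g gE] := alg_inverse q0 (algM _).
  by exists (p * (g \Po q)) => //; rewrite rmorphM /= hornerM map_comp_poly horner_comp -gE.
have Fz : F z by apply: FKz; right.
have FK k : F (j k) by apply: FKz; left; exists k.
elim/poly_ind: q => [|q c IH]; first by rewrite rmorph0 hornerC -(rmorph0 j); apply: FK.
rewrite rmorphD rmorphM /= map_polyX map_polyC /= !hornerE.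
by apply: subfieldD => //; apply: subfieldM.
Qed.

(** Uniqueness of coordinates makes the product of the two transition matrices the identity, which
    bounds n by m. *)
Lemma basis_size_le (E : set M) n m (b : 'I_n -> M) (b' : 'I_m -> M) :
  is_basis KK E b -> is_basis KK E b' -> (n <= m)%N.
Proof.
move=> [Eb bP] [Eb' b'P].
have coord k l (c : 'I_k -> M) (c' : 'I_l -> M) : is_basis KK E c' ->
    (forall i, E (c i)) ->
    exists A : 'M[K]_(k, l), forall i, c i = \sum_(h < l) j (A i h) * c' h.
  move=> [_ c'P] Ec.
  have row i : exists r : 'I_l -> K, c i = \sum_(h < l) j (r h) * c' h.
    have [d [[dK ->] _]] := c'P _ (Ec i).
    have /choice[r rE] : forall h, exists e, j e = d h by move=> h; have [e _ <-] := dK h; exists e.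
    by exists r; apply: eq_bigr => h _; rewrite rE.
  have [r rP] := choice row.
  by exists (\matrix_(i, h) r i h) => i; rewrite rP; apply: eq_bigr => h _; rewrite mxE.
have [A bA] := coord _ _ b b' (conj Eb' b'P) Eb.
have [B b'B] := coord _ _ b' b (conj Eb bP) Eb'.
apply: (@mulmx1_min _ _ _ A B); apply/matrixP => i l.
have [d [_ dU]] := bP _ (Eb i).
have d1 : d = [ffun l => j ((A *m B) i l)].
  apply: dU; split=> [h|]; first by rewrite ffunE; exists ((A *m B) i h).
  rewrite {1}bA; under eq_bigr => h _ do rewrite b'B mulr_sumr.
  rewrite exchange_big; apply: eq_bigr => h _.
  rewrite ffunE mxE rmorph_sum mulr_suml; apply: eq_bigr => k _.
  by rewrite rmorphM mulrA.
have d2 : d = [ffun l => j (1%:M i l)].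
  apply: dU; split=> [h|]; first by rewrite ffunE; exists (1%:M i h).
  rewrite (bigD1 i) //= ffunE mxE eqxx rmorph1 mul1r big1 ?addr0 // => h hi.
  by rewrite ffunE mxE eq_sym (negPf hi) rmorph0 mul0r.
by apply: (fmorph_inj j); move/ffunP: d1 => /(_ l); rewrite d2 !ffunE.
Qed.

Lemma ext_degreeE (E : set M) n (b : 'I_n -> M) :
  is_basis KK E b -> ext_degree KK E = n.
Proof.
move=> bP; apply: xget_unique; first by exists b.
move=> m [b' b'P]; apply/eqP.
by rewrite eqn_leq (basis_size_le bP b'P) (basis_size_le b'P bP).
Qed.

Lemma elt_degreeE z (f : {poly K}) : f \is monic -> root (map_poly j f) z ->
  (forall q, root (map_poly j q) z -> f %| q) -> elt_degree KK z = (size f).-1.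
Proof.
move=> fm fz fmin; set n := (size f).-1.
have sf : size f = n.+1 by rewrite prednK // lt0n size_poly_eq0 monic_neq0.
pose b (i : 'I_n) := z ^+ i.
apply: (@ext_degreeE _ _ b); rewrite adjoinE; split=> [i|_ [q _ <-]].
  by exists 'X^i => //; rewrite map_polyXn hornerXn.
have hornerb (p : {poly K}) : (size p <= n)%N ->
    (map_poly j p).[z] = \sum_(i < n) j p`_i * b i.
  move=> pn; rewrite (@horner_coef_wide _ n) ?size_map_poly //.
  by apply: eq_bigr => i _; rewrite coef_map.
have rn : (size (q %% f)%R <= n)%N by rewrite -ltnS -sf ltn_modp monic_neq0.
exists [ffun i : 'I_n => j (q %% f)`_i]; split.
  split=> [i|]; first by rewrite ffunE; exists (q %% f)`_i.
  rewrite {1}(divp_eq q f) rmorphD rmorphM !hornerE (rootP fz) mulr0 add0r hornerb //.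
  by apply: eq_bigr => i _; rewrite ffunE.
move=> c [cK cE]; apply/ffunP => i; rewrite ffunE.
have /choice[k kE] : forall i, exists k, j k = c i.
  by move=> l; have [k _ <-] := cK l; exists k.
pose p := \poly_(l < n) (if insub l is Some l' then k l' else 0).
have pE (l : 'I_n) : p`_l = k l by rewrite coef_poly ltn_ord valK.
have pz : (map_poly j p).[z] = (map_poly j q).[z].
  rewrite cE hornerb ?size_poly //.
  by apply: eq_bigr => l _; rewrite pE kE.
have /fmin : root (map_poly j (q - p)) z.
  by rewrite /root rmorphB !hornerE pz subrr.
rewrite -kE -pE => /modp_eq0P fqp.
move: fqp; rewrite modpD modpN.
rewrite [p %% f]modp_small ?sf ?ltnS ?size_poly //.
by move=> /subr0_eq ->.
Qed.

Lemma elt_degree_root z (q : {poly K}) : q != 0 -> root (map_poly j q) z ->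
  (elt_degree KK z < size q)%N.
Proof.
move=> q0 qz; have [f [fm fz fmin]] := minpoly_exists (algM z).
rewrite (elt_degreeE fm fz fmin) prednK ?lt0n ?size_poly_eq0 ?monic_neq0 //.
exact: dvdp_leq (fmin _ qz).
Qed.

Lemma elt_degree1 z : elt_degree KK z = 1%N <-> KK z.
Proof.
have [f [fm fz fmin]] := minpoly_exists (algM z); rewrite (elt_degreeE fm fz fmin).
split=> [sf|[k _ kz]].
  have s2 : size f = 2%N.
    by rewrite -[RHS]/(1.+1) -sf prednK // lt0n size_poly_eq0 monic_neq0.
  have [c fE] : exists c, f = 'X + c%:P.
    exists f`_0; apply/polyP => i; rewrite coefD coefX coefC.
    case: i => [|[|i]]; rewrite ?add0r ?addr0 //.
      by rewrite -[f`_1]/(f`_(2.-1)) -s2 -lead_coefE (monicP fm).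
    by rewrite nth_default ?s2.
  exists (- c) => //; apply/eqP; rewrite rmorphN eq_sym -addr_eq0.
  by have := fz; rewrite fE /root rmorphD /= map_polyX map_polyC /= !hornerE.
have : f %| 'X - k%:P.
  by apply: fmin; rewrite rmorphB /= map_polyX map_polyC /= root_XsubC kz.
move/dvdp_leq; rewrite polyXsubC_eq0 size_XsubC => /(_ isT) s2.
have : size f != 1%N.
  apply: contraTneq fz => /eqP /size_poly1P[c c0 ->].
  by rewrite map_polyC rootC fmorph_eq0.
have : size f != 0%N by rewrite size_poly_eq0 monic_neq0.
by case: (size f) s2 => [|[|[|]]].
Qed.

Lemma adjoin_small z x : adjoin KK z x -> exists2 q : {poly K},
  x = (map_poly j q).[z] & (size q <= elt_degree KK z)%N.
Proof.
rewrite adjoinE => -[q _ <-]; have [f [fm fz fmin]] := minpoly_exists (algM z).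
exists (q %% f).
  rewrite {1}(divp_eq q f) rmorphD rmorphM !hornerE (rootP fz) mulr0 add0r //.
rewrite (elt_degreeE fm fz fmin) -ltnS prednK ?lt0n ?size_poly_eq0 ?monic_neq0 //.
by rewrite ltn_modp monic_neq0.
Qed.

End Degree.

(** * Galois groups and the ramification group *)

Section GaloisValued.
Variables (K : fieldType) (Omega : splittingFieldType K) (M : closedFieldType).
Variables (iota : {rmorphism Omega -> M}) (G : oagType) (v : valuation M G).
Implicit Types (s t : gal_of {:Omega}) (z : Omega).

Definition base_map : {rmorphism K -> M} := iota \o in_alg Omega.
Local Notation j := base_map.
Local Notation KK := (base_set iota).
Local Notation L := (range iota `&` abs_ramification_field v KK).

Hypothesis algM : forall x, algebraicOver j x.
Hypothesis galO : galois 1 {:Omega}.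
Hypothesis hens : henselian v KK.

Definition gal_rmorphism s : {rmorphism Omega -> Omega} := (s : 'AEnd(Omega)).

Lemma gal_mul s t z : (s * t)%g z = t (s z).
Proof. by rewrite galM ?memvf. Qed.

Lemma gal_base s k : s (k%:A) = k%:A.
Proof. by rewrite linearZ /= rmorph1. Qed.

Lemma gal_horner s (q : {poly K}) z :
  s (map_poly (in_alg Omega) q).[z] = (map_poly (in_alg Omega) q).[s z].
Proof.
rewrite -[LHS](horner_map (gal_rmorphism s)) -map_poly_comp; congr _.[_].
by apply: eq_map_poly => k /=; apply: gal_base.
Qed.

Lemma gal_fixed_base z : (forall s, s z = z) -> exists k, z = k%:A.
Proof.
move=> zfix; have : z \in fixedField 'Gal({:Omega} / 1)%g.
  by apply/fixedFieldP; rewrite ?memvf.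
move/galois_fixedField: (galO) => ->.
by case/vlineP=> k ->; exists k.
Qed.

Lemma gal_fixed_poly (p : {poly Omega}) :
  (forall s, map_poly s p = p) -> exists q : {poly K}, p = map_poly (in_alg Omega) q.
Proof.
move=> pfix.
have /choice[c cP] : forall i, exists k, p`_i = k%:A.
  by move=> i; apply: gal_fixed_base => s; rewrite -{2}(pfix s) coef_map.
exists (\poly_(i < size p) c i); apply/polyP => i; rewrite coef_map coef_poly.
by case: ltnP => pi; rewrite /= -?cP // scale0r nth_default.
Qed.

(** The pullback of v along s agrees with v on K, so it is v. *)
Lemma v_aut (s : {rmorphism M -> M}) : (forall k, s (j k) = j k) -> forall x, v (s x) = v x.
Proof. by move=> sK; apply: (hens (w := val_pullback s v)) => _ [k _ <-]; rewrite /= [s _]sK. Qed.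

(** The uniqueness in [henselian] concerns valuations of M, hence the detour through a lift of s. *)
Lemma gal_isometry s z : v (iota (s z)) = v (iota z).
Proof.
have sK k : gal_rmorphism s (in_alg Omega k) = in_alg Omega k by apply: gal_base.
have [t tE] := lift_endomorphism algM sK.
have <- : t (iota z) = iota (s z) by apply: tE.
by apply: v_aut => k; rewrite [LHS]tE sK.
Qed.

(** The characteristic polynomial of z over K. *)
Definition orbit_poly z : {poly Omega} := \prod_(s : gal_of {:Omega}) ('X - (s z)%:P).

Lemma orbit_poly_base z : exists q : {poly K}, orbit_poly z = map_poly (in_alg Omega) q.
Proof.
apply: gal_fixed_poly => s.
rewrite /orbit_poly [LHS](rmorph_prod (map_poly (gal_rmorphism s))) /=.
rewrite [RHS](reindex_inj (mulIg s)) /=; apply: eq_bigr => t _.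
by rewrite rmorphB /= map_polyX map_polyC /= gal_mul.
Qed.

Lemma root_orbit_poly z : root (orbit_poly z) z.
Proof.
rewrite /orbit_poly (bigD1 1%g) //= rootM gal_id root_XsubC eqxx.
by [].
Qed.

Lemma poly_over_base (p : {poly M}) : poly_over KK p -> exists q, p = map_poly j q.
Proof.
move=> pK; have /choice[c cP] : forall i, exists k, p`_i = j k.
  by move=> i; have [k _ <-] := pK i; exists k.
exists (\poly_(i < size p) c i); apply/polyP => i; rewrite coef_map coef_poly.
by case: ltnP => pi; [exact: cP|rewrite raddf0 nth_default].
Qed.

Lemma map_poly_base (q : {poly K}) :
  map_poly j q = map_poly iota (map_poly (in_alg Omega) q).
Proof. by rewrite -map_poly_comp. Qed.

(** The minimal polynomial divides the product over the distinct conjugates. This matters because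
    the absolute ramification group is constrained at separable elements only. *)
Lemma separable_base z : separable_over KK (iota z).
Proof.
have [f [fm fz fmin]] := minpoly_exists (algM (iota z)).
exists (map_poly j f).
  split=> [||//|q /poly_over_base[p ->]].
  - by rewrite monic_map.
  - by move=> i; rewrite coef_map; exists f`_i.
  rewrite map_poly_eq0 !size_map_poly => p0 /fmin fp; exact: dvdp_leq.
pose r := undup [seq t z | t : gal_of {:Omega}].
have rfix s : perm_eq (map s r) r.
  have um : uniq (map s r).
    by rewrite map_inj_uniq ?undup_uniq //; apply: (fmorph_inj (gal_rmorphism s)).
  apply: uniq_perm => //; rewrite ?undup_uniq //.
  apply: (uniq_min_size um _ _).2; last by rewrite size_map.
  move=> _ /mapP[_ /[!mem_undup]/mapP[t _ ->] ->].
  by rewrite -gal_mul; apply: map_f; rewrite mem_enum.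
have [|g gE] := gal_fixed_poly (p := \prod_(x <- r) ('X - x%:P)).
  move=> s; rewrite [LHS](rmorph_prod (map_poly (gal_rmorphism s))) /=.
  rewrite -[RHS](perm_big _ (rfix s)) /= big_map; apply: eq_bigr => x _.
  by rewrite rmorphB /= map_polyX map_polyC.
have gz : root (map_poly j g) (iota z).
  rewrite map_poly_base -gE fmorph_root root_prod_XsubC mem_undup.
  by apply/mapP; exists 1%g; rewrite ?gal_id // mem_enum.
apply: (@dvdp_separable _ (map_poly j g)); first by rewrite dvdp_map fmin.
by rewrite map_poly_base -gE separable_map separable_prod_XsubC undup_uniq.
Qed.

Variable a : Omega.
Hypothesis gen : forall z, exists q : {poly K}, z = (map_poly (in_alg Omega) q).[a].

Lemma gal_eq_gen (s t : gal_of {:Omega}) : s a = t a -> s = t.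
Proof.
move=> sa; apply/eqP/gal_eqP => z _; have [q ->] := gen z.
by rewrite !gal_horner sa.
Qed.

Lemma restrict_gal (t : {rmorphism M -> M}) : (forall k, t (j k) = j k) ->
  exists s, forall z, t (iota z) = iota (s z).
Proof.
move=> tK; have [g gE] := orbit_poly_base a.
have tp (q : {poly K}) : map_poly t (map_poly j q) = map_poly j q.
  by rewrite -map_poly_comp; apply: eq_map_poly.
have : root (map_poly j g) (t (iota a)).
  rewrite -tp fmorph_root map_poly_base -gE fmorph_root; exact: root_orbit_poly.
rewrite map_poly_base -gE /orbit_poly rmorph_prod /= /root horner_prod.
move=> /prodf_eq0[s _]; rewrite rmorphB /= map_polyX map_polyC /= !hornerE.
rewrite subr_eq0 => /eqP ta; exists s => z; have [q ->] := gen z.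
rewrite -(horner_map iota) -[LHS](horner_map t) /= -map_poly_base tp ta map_poly_base horner_map.
by rewrite gal_horner.
Qed.

(** * The group R and its fixed field *)

Definition ramified s := forall z, z != 0 -> v (iota z) < v (iota (s z) - iota z).

Definition ramified_set := [set s | `[< ramified s >]]%SET.

Lemma ramified_mul s t : ramified s -> ramified t -> ramified (s * t)%g.
Proof.
move=> sr tr z z0; rewrite gal_mul -[_ - _](subrKA (iota (s z))).
apply: v_gt_add; last exact: sr.
rewrite -(gal_isometry s); apply: tr.
by rewrite (fmorph_eq0 (gal_rmorphism s)).
Qed.

Lemma in_ramified s : (s \in ramified_set) <-> ramified s.
Proof. by rewrite finset.inE; split=> /asboolP. Qed.

Lemma ramified_group_set : group_set ramified_set.
Proof.
apply/group_setP; split=> [|s t].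
  by apply/in_ramified; move=> z z0; rewrite gal_id subrr v_zero v_lt_inf fmorph_eq0.
by move=> /in_ramified sr /in_ramified tr; apply/in_ramified/ramified_mul.
Qed.
Canonical ramified_group := Group ramified_group_set.

(** Elements of R lift to the absolute ramification group, whose members in turn restrict to
    elements of R. *)
Lemma ramfieldP z : abs_ramification_field v KK (iota z) <-> forall s, ramified s -> s z = z.
Proof.
split=> [[_ zfix] s sr|zfix].
  have sK k : gal_rmorphism s (in_alg Omega k) = in_alg Omega k by apply: gal_base.
  have [t [tb tE tr]] := ramification_lift algM v_aut sK sr.
  apply: (fmorph_inj iota); rewrite -[LHS]tE; apply: zfix; split=> //.
    by move=> _ [k _ <-]; rewrite tE sK.
  by move=> x _ x0; apply: tr.
split; first exact: separable_base.
move=> t [_ tK tr]; have [s tE] := restrict_gal (fun k => tK _ (ex_intro2 _ _ k I erefl)).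
rewrite tE zfix // => y y0; rewrite -tE; apply: tr; last by rewrite fmorph_eq0.
exact: separable_base.
Qed.

Lemma conj_ramfield (x : M) :
  conjugate_over L (iota a) x <-> exists2 s, ramified s & x = iota (s a).
Proof.
have LP (p : {poly M}) : poly_over L p <-> exists2 q, p = map_poly iota q &
    forall s, ramified s -> map_poly s q = q.
  split=> [pL|[q -> qfix] i]; last first.
    rewrite coef_map; split; first by exists q`_i.
    by apply/ramfieldP => s /qfix {2}<-; rewrite coef_map.
  have /choice[c cP] : forall i, exists z, iota z = p`_i.
    by move=> i; have [[z _ <-] _] := pL i; exists z.
  have qE : p = map_poly iota (\poly_(i < size p) c i).
    apply/polyP => i; rewrite coef_map coef_poly.
    by case: ltnP => pi; [exact/esym/cP|rewrite raddf0 nth_default].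
  exists (\poly_(i < size p) c i) => // s sr; apply/polyP => i; rewrite coef_map /=.
  have [_] := pL i; rewrite {1}qE coef_map => /ramfieldP; exact.
pose Q := \prod_(s in ramified_group) ('X - (s a)%:P).
have Qfix s : ramified s -> map_poly s Q = Q.
  move=> sr; have sR : s \in ramified_group by apply/in_ramified.
  rewrite /Q [LHS](rmorph_prod (map_poly (gal_rmorphism s))) /=.
  rewrite [RHS](reindex_inj (mulIg s)) /=.
  apply: eq_big => [t|t _]; first by rewrite groupMr.
  by rewrite rmorphB /= map_polyX map_polyC /= gal_mul.
split=> [[p [pm /LP[q pE qfix] pa pmin] px]|[s sr ->]].
  have q0 : q != 0 by rewrite -(map_poly_eq0 iota) -pE monic_neq0.
  have qQ : q %| Q.
    apply: contraT => nd; have r0 : Q %% q != 0 by [].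
    have := pmin (map_poly iota (Q %% q)); rewrite map_poly_eq0 r0 pE !size_map_poly.
    rewrite leqNgt ltn_modp q0; apply=> //.
      apply/LP; exists (Q %% q) => // s sr.
      rewrite [LHS](map_modp (gal_rmorphism s)) -[in RHS](Qfix s sr) -[in RHS](qfix s sr).
      by [].
    have -> : Q %% q = Q - Q %/ q * q by rewrite {2}(divp_eq Q q) addrAC subrr add0r.
    rewrite fmorph_root; move: pa; rewrite pE fmorph_root => /rootP qa.
    rewrite /root !hornerE qa mulr0 subr0 /Q horner_prod.
    by rewrite (bigD1 1%g) ?group1 //= gal_id !hornerE subrr mul0r.
  move: px; rewrite pE => qx.
  have : root (map_poly iota Q) x by have /dvdpP[u ->] := qQ; rewrite rmorphM rootM qx orbT.
  rewrite /Q rmorph_prod /= /root horner_prod => /prodf_eq0[s].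
  move=> /in_ramified sr; rewrite rmorphB /= map_polyX map_polyC /= !hornerE.
  by rewrite subr_eq0 => /eqP; exists s.
(* The minimal polynomial over L is the R-invariant monic one of least size; invariance carries its
   root a to s a. *)
pose Pn n := `[< exists q : {poly Omega}, [/\ q \is monic, root q a,
   forall s, ramified s -> map_poly s q = q & size q = n] >].
have exP : exists n, Pn n.
  exists (size Q); apply/asboolP; exists Q; split=> //.
    by apply: monic_prod => t _; apply: monicXsubC.
  by rewrite /root horner_prod (bigD1 1%g) ?group1 //= gal_id !hornerE subrr mul0r.
have [_ /asboolP[q [qm qa qfix <-]] qmin] := ex_minnP exP.
exists (map_poly iota q); last first.
  by rewrite fmorph_root -{1}(qfix s sr) (fmorph_root (gal_rmorphism s)).
split=> [|||_ /LP[p -> pfix]]; rewrite ?monic_map ?fmorph_root //.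
  by apply/LP; exists q.
rewrite map_poly_eq0 ?fmorph_root !size_map_poly => p0 pa.
have lp0 : lead_coef p != 0 by rewrite lead_coef_eq0.
rewrite -[X in (_ <= X)%N](@size_scale _ (lead_coef p)^-1) ?invr_eq0 //; apply: qmin.
apply/asboolP; exists ((lead_coef p)^-1 *: p); split=> //.
- by rewrite monicE lead_coefZ mulVf.
- by rewrite rootZ // invr_eq0.
move=> t tr; rewrite [LHS](map_polyZ (gal_rmorphism t)) /= pfix //.
congr (_ *: _); rewrite [LHS](fmorphV (gal_rmorphism t)); congr _^-1.
by rewrite -[RHS](congr1 lead_coef (pfix t tr)) [RHS](lead_coef_map (gal_rmorphism t)).
Qed.

End GaloisValued.

(** * Ramification ideals of an extension with a pure generator *)

Section PureGenerator.
Variables (K : fieldType) (Omega : splittingFieldType K) (M : closedFieldType).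
Variables (iota : {rmorphism Omega -> M}) (G : oagType) (v : valuation M G).
Implicit Types s t : gal_of {:Omega}.

Local Notation j := (base_map iota).
Local Notation KK := (base_set iota).
Local Notation L := (range iota `&` abs_ramification_field v KK).
Local Notation vO := (val_pullback iota v).

(** Depth 1 differs from the default 0, so an Okutsu sequence exists. Its set of index 1 consists of
    elements of degree 1, that is, of K, and (OS2) applies to it. *)
Lemma pure_approximation (A : M) : (forall x, algebraicOver j x) -> pure v KK A ->
  (forall k, A != j k) /\
  forall x, (elt_degree KK x < elt_degree KK A)%N ->
    exists k, v (A - x) <= v (A - j k).
Proof.
move=> algM; rewrite /pure /elt_depth.
case: xgetP => // n _ [B [B0 [d [dB [[dA d1 dlt] OS2 _ _ _]]]]] n1; subst n.
have deg1 z : B 1%N z -> KK z by move=> /dB; rewrite d1 => /(_ isT)/(elt_degree1 algM).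
split=> [k|x xA].
  apply: contraTneq (dlt 0%N isT) => Ak; rewrite d1 dA.
  suff -> : elt_degree KK A = 1%N by [].
  by apply/(elt_degree1 algM); exists k.
have [||z /deg1[k _ <-] vz] := OS2 0%N _ x; rewrite ?dA //.
by exists k.
Qed.

Hypothesis algM : forall x, algebraicOver j x.
Hypothesis galO : galois 1 {:Omega}.
Hypothesis hens : henselian v KK.
Variable a : Omega.
Hypothesis gen : forall z, exists q : {poly K}, z = (map_poly (in_alg Omega) q).[a].
Hypothesis pure_a : pure v KK (iota a).

Lemma gen_sub_neq0 k : a - k%:A != 0.
Proof.
have [/(_ k) + _] := pure_approximation algM pure_a.
by rewrite subr_eq0; apply: contra_neq => ->.
Qed.

Lemma approx_seq (r : seq M) :
  (forall x, x \in r -> elt_degree KK x < elt_degree KK (iota a))%N ->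
  exists k, forall x, x \in r -> v (iota a - x) <= v (iota a - j k).
Proof.
have [_ approx] := pure_approximation algM pure_a.
elim: r => [|x r IH] rP; first by exists 0.
have [|k kr] := IH; first by move=> y yr; apply: rP; rewrite seq.inE yr orbT.
have [|l lx] := approx x; first by apply: rP; rewrite seq.inE eqxx.
have [kl|lk] := leP (v (iota a - j k)) (v (iota a - j l)).
  exists l => y; rewrite seq.inE => /orP[/eqP -> //|/kr yk]; exact: le_trans kl.
exists k => y; rewrite seq.inE => /orP[/eqP -> |/kr //].
exact/(le_trans lx)/ltW.
Qed.

(** This is the defining inequality at a - k, which s moves by s a - a. *)
Lemma ramified_gen s k : ramified iota v s ->
  v (iota (a - k%:A)) < v (iota (s a) - iota a).
Proof.
move=> sr; have := sr _ (gen_sub_neq0 k).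
rewrite -!rmorphB [s (a - _)](rmorphB (gal_rmorphism s)) /= gal_base.
by rewrite opprB addrA subrK.
Qed.

(** The condition v z >= g - v (a - k), multiplied out to stay within [vext]. *)
Definition approx_ideal (g : vext G) : set Omega :=
  [set z | exists k : K, g <= v (iota (z * (a - k%:A)))].

Lemma prod_sub1_dvd (R : subringClosed M) (d : M) (I : Type) (r : seq I) (e : I -> M) :
  d \in R -> (forall i, e i \in R) ->
  exists2 f, f \in R & \prod_(i <- r) (1 + d * e i) = 1 + d * f.
Proof.
move=> dR eR; elim/big_rec: _ => [|i _ _ [f fR ->]].
  by exists 0; rewrite ?rpred0 // mulr0 addr0.
exists (e i + f + d * e i * f); first by rewrite !rpredD ?rpredM.
ring.
Qed.

(* Write z as a polynomial in a of degree less than [Omega : K]. The quotient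
   s z / z is the product of the 1 + (s a - a) / (a - r), where r runs over the
   roots of that polynomial, and purity provides one k in K closer to a than all
   of them. *)
Lemma ramified_quotient s (z : Omega) : ramified iota v s -> z != 0 ->
  approx_ideal (v (iota (s a) - iota a)) (s z / z - 1).
Proof.
move=> sr z0; have [q0 zq0] := gen z.
have [|q zq qdeg] := adjoin_small algM (z := iota a) (x := iota z).
  by rewrite adjoinE //; exists q0 => //; rewrite zq0 -horner_map map_poly_base.
have zq' : z = (map_poly (in_alg Omega) q).[a].
  by apply: (fmorph_inj iota); rewrite zq map_poly_base horner_map.
have qn0 : q != 0 by apply: contraNneq z0 => q0'; rewrite zq' q0' rmorph0 horner0.
have [rs rsE] := closed_field_poly_normal (map_poly j q).
have lq0 : lead_coef (map_poly j q) != 0 by rewrite lead_coef_eq0 map_poly_eq0.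
(* The size of q is at most the degree of a, so its roots have smaller degree than a. *)
have [k kP] : exists k, forall x, x \in rs -> v (iota a - x) <= v (iota a - j k).
  apply: approx_seq => x xr; apply: leq_trans qdeg; apply: (elt_degree_root algM) => //.
  by rewrite rsE rootZ // root_prod_XsubC.
have ev (y : M) : (map_poly j q).[y] = lead_coef (map_poly j q) * \prod_(x <- rs) (y - x).
  rewrite {1}rsE hornerZ horner_prod; congr (_ * _).
  by apply: eq_bigr => x _; rewrite !hornerE.
have ar0 x : x \in rs -> iota a - x != 0.
  move=> xr; apply: contraNneq z0 => ax; rewrite -(fmorph_eq0 iota) zq.
  rewrite -[_ == 0]/(root _ _) rsE rootZ // root_prod_XsubC.
  by move/eqP: ax; rewrite subr_eq0 => /eqP ->.
have szE : iota (s z) = (map_poly j q).[iota (s a)].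
  by rewrite zq' gal_horner -horner_map map_poly_base.
have ak0 : iota (a - k%:A) != 0 by rewrite fmorph_eq0 gen_sub_neq0.
pose d := (iota (s a) - iota a) / iota (a - k%:A).
(* The value 0 off the list makes e integral at every index. *)
pose e x := if x \in rs then iota (a - k%:A) / (iota a - x) else 0.
have quot : iota (s z / z) = \prod_(x <- rs) (1 + d * e x).
  rewrite fmorph_div szE zq !ev -mulf_div divff // mul1r -prodf_div.
  rewrite big_seq [RHS]big_seq; apply: eq_bigr => x xr; rewrite /e xr /d mulrA divfK //.
  by field; rewrite ar0.
have dO : d \in vring v by rewrite inE v_le_div // ltW // ramified_gen.
have eO x : e x \in vring v.
  rewrite /e; case: ifP => [xr|_]; last by rewrite rpred0.
  rewrite inE v_le_div ?ar0 //; apply: le_trans (kP _ xr) _.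
  by rewrite rmorphB.
have [f fO prodE] := prod_sub1_dvd rs dO eO.
exists k; rewrite rmorphM rmorphB quot prodE rmorph1 (addrAC 1) subrr add0r mulrAC divfK //.
rewrite -{1}[_ - iota a]mulr1 /=.
have [->|sa0] := eqVneq (iota (s a) - iota a) 0; first by rewrite !mul0r.
by rewrite v_le_mul2l // v_one.
Qed.

(** For sums, the closer of two approximations of a works for both summands. *)
Lemma approx_ideal_vring g : (forall k, v (iota (a - k%:A)) < g) ->
  vring_ideal vO (approx_ideal g).
Proof.
move=> ag; split=> [x [k]|||].
- move=> gx; have := lt_le_trans (ag k) gx; rewrite rmorphM mulrC -{1}[iota (a - _)]mulr1.
  rewrite v_lt_mul2l ?fmorph_eq0 ?gen_sub_neq0 // v_one; exact: ltW.
- by exists 0; rewrite mul0r rmorph0 v_zero v_le_inf.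
- move=> x y [k kx] [l ly].
  have [kl|lk] := leP (v (iota (a - k%:A))) (v (iota (a - l%:A))).
    exists l; rewrite mulrDl rmorphD v_ge_add //; apply: le_trans kx _.
    have [->|x0] := eqVneq x 0; first by rewrite !mul0r.
    by rewrite !rmorphM v_le_mul2l // fmorph_eq0.
  exists k; rewrite mulrDl rmorphD v_ge_add //; apply: le_trans ly _.
  have [->|y0] := eqVneq y 0; first by rewrite !mul0r.
  by rewrite !rmorphM v_le_mul2l ?fmorph_eq0 // ltW.
move=> c x c0 [k kx]; exists k; apply: le_trans kx _; rewrite -mulrA (rmorphM iota c) [iota c * _]mulrC.
have [->|y0] := eqVneq (x * (a - k%:A)) 0; first by rewrite rmorph0 mul0r.
by rewrite -{1}[iota (x * _)]mulr1 v_le_mul2l ?fmorph_eq0 // v_one.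
Qed.

Lemma subgroup_idealE (H : {group gal_of {:Omega}}) s0 :
  (forall s, s \in H -> ramified iota v s) -> s0 \in H -> s0 != 1%g ->
  (forall s, s \in H -> s != 1%g ->
    v (iota (s0 a) - iota a) <= v (iota (s a) - iota a)) ->
  subgroup_ideal vO H = approx_ideal (v (iota (s0 a) - iota a)).
Proof.
move=> Hr s0H s01 s0min; apply/seteqP; split=> [|x [k kx] I [/= Iideal genI]].
  apply: smallest_sub => [|_ [s [z [sH z0 ->]]]].
    by apply: approx_ideal_vring => k; apply: ramified_gen; apply: Hr.
  have [->|s1] := eqVneq s 1%g.
    exists 0; rewrite gal_id divff // subrr mul0r rmorph0 v_zero.
    exact: v_le_inf.
  have [k kz] := ramified_quotient (Hr _ sH) z0.
  by exists k; apply: le_trans kz; apply: s0min.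
have [_ _ _ Imul] := Iideal.
have ak0 := gen_sub_neq0 k.
have sa0 : s0 a - a != 0.
  by rewrite subr_eq0; apply: contra_neq s01 => s0a; apply: (gal_eq_gen gen); rewrite gal_id.
(* The generator obtained from z = a - k equals (s0 a - a) / (a - k), and the cofactor is integral
   by the choice of k. *)
have -> : x = x * (a - k%:A) / (s0 a - a) * (s0 (a - k%:A) / (a - k%:A) - 1).
  rewrite [s0 (a - _)](rmorphB (gal_rmorphism s0)) /= gal_base.
  by field; rewrite ak0 sa0.
apply: Imul; last by apply: genI; exists s0, (a - k%:A).
by rewrite /= fmorph_div v_le_div ?fmorph_eq0 // rmorphB.
Qed.

Lemma conj_distE : conj_dist v L (iota a) =
  [set v (iota (s a) - iota a) | s in [set s | ramified iota v s /\ s != 1%g]].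
Proof.
apply/seteqP; split=> [_ [x [xa /(conj_ramfield algM galO hens gen)[s sr xE]] <-]|].
  exists s; last by rewrite xE v_sub_sym.
  by split=> //; apply: contra_notN xa => /eqP s1; rewrite xE s1 gal_id.
move=> _ [s [sr s1] <-]; exists (iota (s a)); last by rewrite v_sub_sym.
split; last by apply/(conj_ramfield algM galO hens gen); exists s.
move=> /(fmorph_inj iota) sa; case/eqP: s1.
by apply: (gal_eq_gen gen); rewrite gal_id.
Qed.

Lemma gal_gen_sub_neq0 s : s != 1%g -> s a - a != 0.
Proof.
by rewrite subr_eq0; apply: contra_neq => sa; apply: (gal_eq_gen gen); rewrite gal_id.
Qed.

(** For g in S_L(a), a subgroup of R whose least distance is g; it realizes [approx_ideal g] as a
    ramification ideal. *)
Definition ball_set (g : vext G) : {set gal_of {:Omega}} :=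
  [set s | `[< ramified iota v s /\ g <= v (iota (s a) - iota a) >]]%SET.

Lemma in_ball g s :
  s \in ball_set g <-> ramified iota v s /\ g <= v (iota (s a) - iota a).
Proof. by rewrite finset.inE; split=> /asboolP. Qed.

Lemma ball_group_set g : group_set (ball_set g).
Proof.
apply/group_setP; split=> [|s t /in_ball[sr sg] /in_ball[tr tg]]; apply/in_ball.
  split; last by rewrite gal_id subrr v_zero v_le_inf.
  by move=> z z0; rewrite gal_id subrr v_zero v_lt_inf fmorph_eq0.
split; first exact: ramified_mul.
rewrite gal_mul -[_ - _](subrKA (iota (t a))) v_ge_add //.
rewrite -rmorphB -[t _ - t _](rmorphB (gal_rmorphism t)) /=.
by rewrite gal_isometry // rmorphB.
Qed.

Lemma sub_gal (H : {set gal_of {:Omega}}) : H \subset 'Gal({:Omega} / 1)%g.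
Proof.
apply/fintype.subsetP => s _; rewrite gal_kHom ?sub1v //; apply/kAHomP => _ /vlineP[k ->].
exact: gal_base.
Qed.

Theorem ramification_idealsE :
  ramification_ideals vO = approx_ideal @` conj_dist v L (iota a).
Proof.
rewrite conj_distE; apply/seteqP; split=> [I [[x Ix x0] IM [H _ IE]]|].
  (* Containment of I in the maximal ideal forces H into R. *)
  have Hr s : s \in H -> ramified iota v s.
    move=> sH z z0; have : I (s z / z - 1).
      by rewrite IE => A [_]; apply; exists s, z.
    have zz : s z / z - 1 = (s z - z) / z by field.
    by move/IM; rewrite /= zz fmorph_div v_lt_div ?fmorph_eq0 // rmorphB.
  have [s1 s1H s1n] : exists2 s, s \in H & s != 1%g.
    apply: contrapT => H1; case/eqP: x0.
    suff : subgroup_ideal vO H `<=` [set 0] by move=> I0; apply: I0; rewrite -IE.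
    apply: smallest_sub => [|_ [s [z [sH z0 ->]]]].
      split=> [_ ->|//|_ _ -> ->|c _ _ ->] /=; rewrite ?addr0 ?mulr0 //.
      by rewrite rmorph0 v_zero.
    have -> : s = 1%g by apply: contra_notP H1 => /eqP; exists s.
    by rewrite /= gal_id divff // subrr.
  pose P s := (s \in H) && (s != 1%g).
  have Ps1 : P s1 by rewrite /P s1H.
  case: (@arg_minP _ _ _ s1 P (fun s => v (iota (s a) - iota a)) Ps1).
  move=> s0 /andP[s0H s0n] s0min; exists (v (iota (s0 a) - iota a)).
    by exists s0 => //; split=> //; apply: Hr.
  rewrite IE; apply/esym/subgroup_idealE => // s sH sn.
  by apply: s0min; rewrite /P sH.
move=> _ [_ [s [sr s1] <-] <-].
pose H := Group (ball_group_set (v (iota (s a) - iota a))).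
have Hr t : t \in H -> ramified iota v t by move=> /in_ball[].
have sH : s \in H by apply/in_ball.
have a0 : a != 0 by have := gen_sub_neq0 0; rewrite scale0r subr0.
split.
- exists ((s a - a) / a); last by rewrite mulf_neq0 ?invr_eq0 ?gal_gen_sub_neq0.
  by exists 0; rewrite scale0r subr0 divfK // rmorphB.
- move=> x [k kx] /=; have := lt_le_trans (ramified_gen k sr) kx.
  by rewrite mulrC rmorphM -{1}[iota (a - _)]mulr1 v_lt_mul2l ?fmorph_eq0 ?gen_sub_neq0 // v_one.
exists H; first exact: sub_gal.
apply/esym/subgroup_idealE => // t /in_ball[].
by [].
Qed.

(* If two distances give the same ideal, then multiplication by an element d of
   positive value does not leave the cofinal set of the v (a - k). *)
Lemma approx_ideal_eq g h : conj_dist v L (iota a) g -> conj_dist v L (iota a) h ->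
  g < h -> approx_ideal g = approx_ideal h ->
  exists d : Omega, [/\ d != 0, VFin 0 < v (iota d) &
    forall k, exists l, v (iota (d * (a - k%:A))) <= v (iota (a - l%:A))].
Proof.
rewrite conj_distE => -[s [sr s1] <-] [t [tr t1] <-] st eqI.
have sa0 := gal_gen_sub_neq0 s1; have ta0 := gal_gen_sub_neq0 t1.
exists ((t a - a) / (s a - a)); split.
- by rewrite mulf_neq0 ?invr_eq0.
- by rewrite fmorph_div v_lt_div ?fmorph_eq0 // !rmorphB.
move=> k; have ak0 := gen_sub_neq0 k.
(* This element has the least value that k allows in the first ideal; its membership in the second
   yields l. *)
have : approx_ideal (v (iota (s a) - iota a)) ((s a - a) / (a - k%:A)).
  by exists k; rewrite divfK // rmorphB.
rewrite eqI => -[l]; rewrite -rmorphB => tl; exists l.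
have c0 : iota ((s a - a) / (a - k%:A)) != 0.
  by rewrite fmorph_eq0 mulf_neq0 // invr_eq0.
rewrite -(v_le_mul2l v _ _ c0) -!rmorphM.
have -> : (s a - a) / (a - k%:A) * ((t a - a) / (s a - a) * (a - k%:A)) = t a - a.
  by field; rewrite ak0 sa0.
exact: tl.
Qed.

Lemma approx_ideal_inj :
  (forall d : Omega, d != 0 -> VFin 0 < v (iota d) ->
    ~ forall k, exists l, v (iota (d * (a - k%:A))) <= v (iota (a - l%:A))) ->
  {in conj_dist v L (iota a) &, injective approx_ideal}.
Proof.
move=> nod g h /set_mem Sg /set_mem Sh eqI; apply/eqP; case: ltgtP => // gh.
- by have [d [d0 dp dk]] := approx_ideal_eq Sg Sh gh eqI; case: (nod d d0 dp).
- by have [d [d0 dp dk]] := approx_ideal_eq Sh Sg gh (esym eqI); case: (nod d d0 dp).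
Qed.

(** At a best approximation, a positive shift would lead to a strictly better one. *)
Lemma max_approx_ideal_inj k :
  (forall l, v (iota (a - l%:A)) <= v (iota (a - k%:A))) ->
  {in conj_dist v L (iota a) &, injective approx_ideal}.
Proof.
move=> kmax; apply: approx_ideal_inj => d d0 dp /(_ k)[l dk].
have := le_trans dk (kmax l); rewrite leNgt mulrC rmorphM.
by rewrite -{1}[iota (a - _)]mulr1 v_lt_mul2l ?v_one ?dp // fmorph_eq0 gen_sub_neq0.
Qed.

(** The norm of x lies in K, and all its factors have the value of x. *)
Lemma norm_base (x : Omega) :
  exists k : K, v (j k) = v (iota x ^+ #|{: gal_of {:Omega}}|).
Proof.
have [|k kE] := gal_fixed_base galO (z := \prod_(s : gal_of {:Omega}) s x).
  move=> s; rewrite [LHS](rmorph_prod (gal_rmorphism s)) /=.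
  by rewrite [RHS](reindex_inj (mulIg s)) /=; apply: eq_bigr => t _; rewrite gal_mul.
exists k; rewrite /base_map /= -kE rmorph_prod /=.
rewrite -prodr_const; apply: v_prodE => s _; exact: gal_isometry.
Qed.

Lemma v_natmul (x : M) g n : v x = VFin g -> v (x ^+ n) = VFin (g *+ n).
Proof.
move=> xg; elim: n => [|n IH]; first by rewrite v_one.
by rewrite exprS v_mul xg IH /= mulrS.
Qed.

(* The v (a - k) being bounded by any element of the conjugate distances, the
   multiples of v d would be bounded too. Norms move the comparison to vK. *)
Lemma rank_one_approx_ideal_inj :
  rank_one (value_group v KK) -> {in conj_dist v L (iota a) &, injective approx_ideal}.
Proof.
move=> [_ arch] g h Sg Sh; apply: approx_ideal_inj (Sg) Sh => d d0 dp dk.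
move: Sg => /set_mem; rewrite conj_distE => -[s [sr s1] _].
have sa0 := gal_gen_sub_neq0 s1.
have a0 : a != 0 by have := gen_sub_neq0 0; rewrite scale0r subr0.
(* Iterating the shift from k = 0 stays below some v (a - l), hence below v (s a - a). *)
have far n : v (iota (d ^+ n * a)) < v (iota (s a - a)).
  have [l dl] : exists l, v (iota (d ^+ n * a)) <= v (iota (a - l%:A)).
    elim: n => [|n [l dl]]; first by exists 0; rewrite mul1r scale0r subr0.
    have [l' dl'] := dk l; exists l'; apply: le_trans dl'.
    by rewrite exprS -mulrA (rmorphM iota d) [X in _ <= v X]rmorphM v_le_mul2l // fmorph_eq0.
  by apply: le_lt_trans dl _; rewrite (rmorphB iota (s a)); apply: ramified_gen.
set N := #|{: gal_of {:Omega}}|.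
have N0 : (0 < N)%N by apply/card_gt0P; exists 1%g.
have [kd kdE] := norm_base d.
have [ke keE] := norm_base ((s a - a) / a).
have iX0 (x : Omega) m : x != 0 -> iota x ^+ m != 0 by move=> x0; rewrite expf_neq0 // fmorph_eq0.
have [gd gdE] := v_fin v (iX0 d N d0).
have [ge geE] := v_fin v (iX0 _ N (mulf_neq0 sa0 (invr_neq0 a0))).
have [|||n] := arch gd ge.
- by exists (j kd); [exists kd|rewrite kdE].
- by exists (j ke); [exists ke|rewrite keE].
- have : VFin 0 < v (iota d ^+ N) by rewrite -(v_one v) -(expr1n _ N) v_ltE_exp // v_one.
  by rewrite gdE vext_lt_fin.
rewrite -[_ <= _]/(VFin ge <= VFin (gd *+ n)) -(v_natmul n gdE) -geE leNgt.
rewrite -exprM mulnC exprM v_ltE_exp //.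
have : v (iota (a * d ^+ n)) < v (iota (a * ((s a - a) / a))).
  by rewrite mulrC [X in _ < v (iota X)]mulrC divfK // far.
by rewrite !rmorphM v_lt_mul2l ?fmorph_eq0 // rmorphXn.
Qed.

End PureGenerator.

(** * Defectless and purely wild extensions *)

Lemma char_exponent_root1 (F : fieldType) (x : F) n :
  x ^+ (char_exponent F ^ n)%N = 1 -> x = 1.
Proof.
rewrite /char_exponent; case: xgetP => [p _ /= pF|_]; last by rewrite exp1n.
elim: n => // n IH; rewrite expnSr exprM => xp; apply: IH.
apply: (fmorph_inj (pFrobenius_aut pF)).
by rewrite rmorph1 [LHS]pFrobenius_autE.
Qed.

Section Defectless.
Variables (K : fieldType) (Omega : splittingFieldType K) (M : closedFieldType).
Variables (iota : {rmorphism Omega -> M}) (G : oagType) (v : valuation M G).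
Local Notation j := (base_map iota).
Local Notation KK := (base_set iota).
Hypothesis algM : forall x, algebraicOver j x.

Lemma base_scale k (x : Omega) : iota (k *: x) = j k * iota x.
Proof. by rewrite -mulr_algl rmorphM. Qed.

Lemma ext_degree_dim : ext_degree KK (range iota) = \dim {:Omega}.
Proof.
pose b (i : 'I_(\dim {:Omega})) := iota (vbasis {:Omega})`_i.
apply: (@ext_degreeE _ _ j _ _ b); split=> [i|_ [x _ <-]]; first by exists (vbasis {:Omega})`_i.
have bE (c : 'I_(\dim {:Omega}) -> K) :
    iota (\sum_i c i *: (vbasis {:Omega})`_i) = \sum_i j (c i) * b i.
  by rewrite rmorph_sum; apply: eq_bigr => i _; rewrite base_scale.
exists [ffun i => j (coord (vbasis {:Omega}) i x)]; split.
  split=> [i|]; first by rewrite ffunE; exists (coord (vbasis {:Omega}) i x).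
  rewrite {1}(coord_vbasis (memvf x)) bE.
  by apply: eq_bigr => i _; rewrite ffunE.
move=> c [cK cE]; apply/ffunP => i; rewrite ffunE.
have /choice[k kE] : forall i, exists e, j e = c i.
  by move=> l; have [e _ <-] := cK l; exists e.
have -> : x = \sum_i k i *: (vbasis {:Omega})`_i.
  apply: (fmorph_inj iota); rewrite bE cE.
  by apply: eq_bigr => l _; rewrite kE.
by rewrite coord_sum_free ?kE // (basis_free (vbasisP _)).
Qed.

(** Some coordinate of 1 contributes a term of value at most 0. Choose k so that a - k has
    coordinate 0 there: the same coordinate of a - l then gives v (a - l) <= v (k - l), whence v (a
    - l) <= v (a - k). *)
Lemma valuation_basis_max (a : Omega) (I : finType) (w : I -> Omega) :
  (forall (k : I -> K) i,
     v (iota (\sum_i k i *: w i)) <= v (iota (k i *: w i))) ->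
  (forall x, exists k : I -> K, x = \sum_i k i *: w i) ->
  exists k, forall l, v (iota (a - l%:A)) <= v (iota (a - k%:A)).
Proof.
move=> indep span; have [al aE] := span a; have [ep eE] := span 1.
have [i0 ei0] : exists i, v (iota (ep i *: w i)) <= VFin 0.
  apply: contrapT => ne; have : VFin 0 < v (iota 1).
    rewrite eE rmorph_sum; apply: v_gt_sum => i _.
    by rewrite ltNge; apply/negP => ei; apply: ne; exists i.
  by rewrite rmorph1 v_one ltxx.
have e0 : ep i0 != 0.
  by apply: contraTneq ei0 => ->; rewrite scale0r rmorph0 v_zero.
exists (al i0 / ep i0) => l; set k := al i0 / ep i0.
have vkl : v (iota (a - l%:A)) <= v (iota (k - l)%:A).
  have -> : a - l%:A = \sum_i (al i - l * ep i) *: w i.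
    rewrite {1}aE eE scaler_sumr -sumrB; apply: eq_bigr => i _.
    by rewrite scalerBl scalerA.
  apply: le_trans (indep _ i0) _.
  have -> : al i0 - l * ep i0 = (k - l) * ep i0 by rewrite /k mulrBl divfK.
  rewrite -scalerA base_scale -[leRHS]/(v (j (k - l))).
  have [->|kl0] := eqVneq (j (k - l)) 0; first by rewrite mul0r.
  by rewrite -[X in _ <= v X]mulr1 v_le_mul2l // v_one.
have -> : a - k%:A = (a - l%:A) - (k - l)%:A by rewrite scalerBl opprB addrA subrK.
by rewrite (rmorphB iota (a - l%:A)) v_ge_sub.
Qed.

Lemma group_index_gt0 (A B : set G) : (0 < group_index A B)%N ->
  exists b : 'I_(group_index A B) -> G,
    (forall i, B (b i)) /\ forall x, B x -> exists! i, A (x - b i).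
Proof. by rewrite /group_index; case: xgetP => [n _ [b bP] _|//]; exists b. Qed.

Lemma ext_degree_gt0 (F : fieldType) (A B : set F) : (0 < ext_degree A B)%N ->
  exists b : 'I_(ext_degree A B) -> F, is_basis A B b.
Proof. by rewrite /ext_degree; case: xgetP => [n _ [b bP] _|//]; exists b. Qed.

(** Divide by the coefficient of least value: a coefficient becomes 1, so the residue is a
    nontrivial combination of the basis c and the quotient is a unit. *)
Lemma residue_independence n (c : 'I_n -> resfield v) (u : 'I_n -> Omega) :
  is_basis (@residue_set _ _ v KK) (@residue_set _ _ v (range iota)) c ->
  (forall i, iota (u i) \in vring v) -> (forall i, red v (iota (u i)) = c i) ->
  forall k : 'I_n -> K,
    exists2 l, v (iota (\sum_i k i *: u i)) = v (j l) & forall i, v (j l) <= v (j (k i)).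
Proof.
move=> [Ec cP] uO uc k.
have [k0|/existsNP[i1 ki1]] := pselect (forall i, k i = 0).
  exists 0; rewrite ?rmorph0; last by move=> i; rewrite k0 rmorph0.
  by rewrite big1 ?rmorph0 // => i _; rewrite k0 scale0r.
have [l _ lmin] := @arg_minP _ _ _ i1 xpredT (fun i => v (j (k i))) isT.
have kl0 : k l != 0.
  have ki0 : j (k i1) != 0 by rewrite fmorph_eq0; apply/eqP.
  by rewrite -(fmorph_eq0 j) -(v_lt_inf v) (le_lt_trans (lmin i1 isT)) // v_lt_inf.
exists (k l); last by move=> i; apply: lmin.
pose d i := k i / k l.
have dO i : j (d i) \in vring v by rewrite inE fmorph_div v_le_div ?fmorph_eq0 ?lmin.
have dE : \sum_i k i *: u i = k l *: \sum_i d i *: u i.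
  rewrite scaler_sumr; apply: eq_bigr => i _.
  by rewrite scalerA /d mulrC divfK.
suff v0 : v (iota (\sum_i d i *: u i)) = VFin 0.
  by rewrite dE base_scale v_mul v0 -(v_one v) -v_mul mulr1.
have sE : iota (\sum_i d i *: u i) = \sum_i j (d i) * iota (u i).
  by rewrite rmorph_sum; apply: eq_bigr => i _; rewrite base_scale.
have sO : iota (\sum_i d i *: u i) \in vring v.
  by rewrite sE rpred_sum // => i _; rewrite rpredM.
apply/le_anti/andP; split; last by [].
rewrite leNgt -red_eq0 //; apply/eqP => s0.
have E0 : @residue_set _ _ v (range iota) 0.
  have <- : red v 0 = 0 by apply/eqP; rewrite red_eq0 ?rpred0 // v_zero.
  by apply: residue_set_red; rewrite ?rpred0 //; exists 0; rewrite ?rmorph0.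
have K0 : @residue_set _ _ v KK 0.
  have <- : red v 0 = 0 by apply/eqP; rewrite red_eq0 ?rpred0 // v_zero.
  by apply: residue_set_red; rewrite ?rpred0 //; exists 0; rewrite ?scale0r ?rmorph0.
have [e [_ eU]] := cP 0 E0.
have e0 : e = [ffun=> 0].
  apply: eU; split=> [i|]; first by rewrite ffunE.
  by rewrite big1 // => i _; rewrite ffunE mul0r.
have ed : e = [ffun i => red v (j (d i))].
  apply: eU; split=> [i|].
    by rewrite ffunE; apply: residue_set_red => //; exists (d i).
  rewrite -[LHS]s0 sE red_sum => [|i]; last by rewrite rpredM.
  by apply: eq_bigr => i _; rewrite ffunE redM // uc.
move/ffunP: ed => /(_ l); rewrite e0 !ffunE /d divff // rmorph1 red1.
by move/esym/eqP; rewrite oner_eq0.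
Qed.

(** Products of representatives of the value cosets with lifts of a residue basis are valuation
    independent. Without defect there are [Omega : K] of them, so they form a basis. *)
Lemma defectless_max (a : Omega) : (0 < ext_degree KK (range iota))%N ->
  defectless v KK (range iota) ->
  exists k, forall l, v (iota (a - l%:A)) <= v (iota (a - k%:A)).
Proof.
rewrite /defectless /defect => n0; case: xgetP => [d _ /= + d1|//].
rewrite d1 muln1 /ramification_index /residue_degree => nE.
(* Positivity excludes the default 0 of both indices, so representatives and a residue basis
   exist. *)
move: (n0); rewrite nE muln_gt0 => /andP[e0 f0].
have [b [bO bP]] := group_index_gt0 e0.
have [c cP] := ext_degree_gt0 f0.
move: b bO bP c cP nE; set e := group_index _ _; set f := ext_degree _ (@residue_set _ _ v (range iota)).
move=> b bO bP c cP nE {e0 f0}.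
have /choice[z zE] : forall i, exists z, v (iota z) = VFin (b i).
  by move=> i; have [_ [z _ <-] zb] := bO i; exists z.
have /choice[u uP] : forall i, exists u, iota u \in vring v /\ red v (iota u) = c i.
  by move=> i; have [Ec _] := cP; have /residue_setP[_ [[u _ <-] uO ur]] := Ec i; exists u.
have uO i : iota (u i) \in vring v by have [] := uP i.
have uc i : red v (iota (u i)) = c i by have [] := uP i.
have resind := residue_independence cP uO uc.
have cosets i i' k k' : k != 0 ->
    v (iota (z i) * j k) = v (iota (z i') * j k') -> i = i'.
  move=> k0 eqv; have zk0 : iota (z i) * j k != 0.
    by rewrite mulf_neq0 ?fmorph_eq0 // -(fmorph_eq0 iota) -(v_lt_inf v) zE.
  have := v_eq_neq0 eqv zk0; rewrite mulf_eq0 negb_or => /andP[_ k'0].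
  have [g gE] : exists g, v (j k) = VFin g by apply: v_fin; rewrite fmorph_eq0.
  have [h hE] : exists h, v (j k') = VFin h by apply: v_fin.
  move: eqv; rewrite !v_mul !zE gE hE => -[bgh].
  have [i0 [_ iU]] := bP (b i) (bO i).
  rewrite -(iU i); last by exists 1; rewrite ?subrr ?v_one //; exists 1; rewrite // scale1r rmorph1.
  apply: iU; exists (j (k' / k)); first by exists (k' / k).
  rewrite fmorph_div (v_divE hE gE); congr VFin.
  by apply/eqP; rewrite subr_eq addrAC bgh addrAC subrr add0r.
pose w (p : 'I_e * 'I_f) := z p.1 * u p.2.
have indep (k : 'I_e * 'I_f -> K) p :
    v (iota (\sum_p k p *: w p)) <= v (iota (k p *: w p)).
  pose y i := \sum_l k (i, l) *: u l.
  have -> : \sum_p k p *: w p = \sum_i z i * y i.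
    under [RHS]eq_bigr => i _ do rewrite mulr_sumr.
    rewrite pair_bigA; apply: eq_bigr => -[i l] _ /=.
    by rewrite /w scalerAr.
  have /choice[la laE] : forall i, exists l, v (iota (y i)) = v (j l) /\
      forall l', v (j l) <= v (j (k (i, l'))).
    by move=> i; have [l l1 l2] := resind (fun l => k (i, l)); exists l.
  have vzy i : v (iota (z i * y i)) = v (iota (z i) * j (la i)).
    by rewrite rmorphM; apply: v_mulE => //; have [] := laE i.
  have z0 i : iota (z i) != 0 by rewrite -(v_lt_inf v) zE.
  apply: (@le_trans _ _ (v (iota (z p.1 * y p.1)))); last first.
    rewrite vzy /w base_scale rmorphM mulrCA mulrA.
    apply: le_trans (_ : v (iota (z p.1) * j (k p)) <= _).
      by rewrite v_le_mul2l //; case: (p) => i l /=; have [_ ->] := laE i.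
    have [->|zk0] := eqVneq (iota (z p.1) * j (k p)) 0; first by rewrite mul0r.
    rewrite -[X in v X <= _]mulr1 v_le_mul2l // v_one; exact: uO.
  (* Nonzero terms with different i have values in different cosets of vK, so a finite minimum is
     attained once and is the value of the sum. *)
  have [i0 _ i0min] := @arg_minP _ _ _ p.1 xpredT (fun i => v (iota (z i * y i))) isT.
  apply: le_trans (i0min p.1 isT).
  have [zy0|zy0] := eqVneq (z i0 * y i0) 0; first by rewrite zy0 rmorph0 v_zero v_le_inf.
  have [g gE] : exists g, v (iota (z i0 * y i0)) = VFin g by apply: v_fin; rewrite fmorph_eq0.
  rewrite (bigD1 i0) //= rmorphD v_add_eq // gE rmorph_sum; apply: v_gt_sum => i ii0.
  rewrite -gE lt_neqAle i0min // andbT; apply: contra ii0 => /eqP eqv; apply/eqP/esym.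
  move: eqv; rewrite !vzy; apply: cosets; rewrite -(fmorph_eq0 j) -(v_lt_inf v).
  have [<- _] := laE i0; rewrite v_lt_inf fmorph_eq0.
  by apply: contraNneq zy0 => ->; rewrite mulr0.
apply: (@valuation_basis_max a _ w) => // x.
have w0 p : w p != 0.
  apply: mulf_neq0; first by rewrite -(fmorph_eq0 iota) -(v_lt_inf v) zE.
  have [l lE /(_ p.2)] := resind (fun i => (i == p.2)%:R).
  rewrite -lE eqxx rmorph1 v_one (bigD1 p.2) //= eqxx scale1r big1 ?addr0 => [ul|i /negPf ->].
    by rewrite -(fmorph_eq0 iota) -(v_lt_inf v) (le_lt_trans ul).
  by rewrite scale0r.
pose X := [tuple w (enum_val i) | i < #|{: 'I_e * 'I_f}|].
have Xfree : free X.
  apply/freeP => k k0 i; pose k' p := k (enum_rank p).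
  have := indep k' (enum_val i).
  rewrite (_ : \sum_p _ = 0) ?rmorph0 ?v_zero; last first.
    rewrite -[RHS]k0 (reindex _ (onW_bij _ (enum_val_bij _))) /=.
    by apply: eq_bigr => l _; rewrite /k' enum_valK (nth_map l) ?size_enum_ord // nth_ord_enum.
  rewrite /k' enum_valK => kw; apply/eqP; apply: contraLR kw => ki0.
  by rewrite -ltNge v_lt_inf fmorph_eq0 scaler_eq0 negb_or ki0 w0.
have Xbasis : basis_of {:Omega} X.
  rewrite basisEfree Xfree subvf size_tuple card_prod !card_ord -ext_degree_dim.
  by rewrite -nE leqnn.
exists (fun p => coord X (enum_rank p) x).
rewrite {1}(coord_basis Xbasis (memvf x)).
rewrite [RHS](reindex _ (onW_bij _ (enum_val_bij _))) /=.
by apply: eq_bigr => l _; rewrite enum_valK (nth_map l) ?size_enum_ord // nth_ord_enum.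
Qed.

End Defectless.

(** * Purely wild extensions, where R is the whole Galois group *)

Section PurelyWild.
Variables (K : fieldType) (Omega : splittingFieldType K) (M : closedFieldType).
Variables (iota : {rmorphism Omega -> M}) (G : oagType) (v : valuation M G).
Local Notation j := (base_map iota).
Local Notation KK := (base_set iota).
Hypothesis algM : forall x, algebraicOver j x.
Hypothesis galO : galois 1 {:Omega}.
Hypothesis hens : henselian v KK.

(* Up to a factor from K, some p-power of z has a residue in Kv, hence (s z / z)
   raised to a power of p is congruent to 1. *)
Lemma purely_wild_ramified s : purely_wild v KK (range iota) -> ramified iota v s.
Proof.
move=> [_ wildG wildk] z z0; set p := residue_char_exponent v.
have iz0 : iota z != 0 by rewrite fmorph_eq0.
have [g zg] := v_fin v iz0.
have [n [_ [k _ <-] kE]] : exists n, value_group v KK (g *+ (p ^ n)%N).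
  by apply: wildG; exists (iota z) => //; exists z.
have k0 : j k != 0 by rewrite -(v_lt_inf v) [v _]kE.
have vzk : v (iota z ^+ (p ^ n)) = v (j k) by rewrite (v_natmul _ zg) [RHS]kE.
pose u := z ^+ (p ^ n) / k%:A.
have uE : iota u = iota z ^+ (p ^ n) / j k by rewrite fmorph_div rmorphXn.
have vu : v (iota u) = VFin 0.
  by rewrite uE -(v_one v) -(divff k0); apply: v_mulE.
have uO : iota u \in vring v by rewrite inE vu.
have [m] : exists m, @residue_set _ _ v KK (red v (iota u) ^+ (p ^ m)).
  by apply: wildk; apply: residue_set_red => //; exists u.
have redX (x : M) q : x \in vring v -> red v (x ^+ q) = red v x ^+ q.
  move=> xO; elim: q => [|q IH]; first by rewrite red1.
  by rewrite !exprS redM ?rpredX // IH.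
rewrite -redX // => /residue_setP[_ [[l _ <-] lO lu]].
have close : VFin 0 < v (iota (u ^+ (p ^ m) - l%:A)).
  by rewrite rmorphB rmorphXn -red_eq0 ?rpredB ?rpredX // redB ?rpredX // lu subrr.
have vsz : v (iota (s z)) = v (iota z) by apply: gal_isometry.
have tO : iota (s z / z) \in vring v by rewrite inE fmorph_div v_le_div // vsz.
suff : red v (iota (s z / z)) = 1.
  move/eqP; rewrite -subr_eq0 -(red1 v) -redB ?rpred1 // red_eq0 ?rpredB ?rpred1 //.
  rewrite -(rmorph1 iota) -rmorphB -v_lt_div // -rmorphB -fmorph_div.
  by rewrite mulrBl divff.
apply: (@char_exponent_root1 _ _ (n + m)); rewrite -redX // -[X in (X ^ _)%N]/p.
(* The factor k in u is fixed by s and cancels. *)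
have -> : iota (s z / z) ^+ (p ^ (n + m)) = iota (s u ^+ (p ^ m) / u ^+ (p ^ m)).
  rewrite /u [s (_ / _)](fmorph_div (gal_rmorphism s)) /= gal_base.
  rewrite -!rmorphXn expnD exprM !expr_div_n; congr (iota _).
  have kA0 : k%:A != 0 :> Omega by rewrite -(fmorph_eq0 iota).
  rewrite invf_div mulrA divfK ?expf_neq0 //.
  by rewrite [X in _ = X ^+ _ / _](rmorphXn (gal_rmorphism s)).
have u0 : u ^+ (p ^ m) != 0.
  by rewrite expf_neq0 // -(fmorph_eq0 iota) -(v_lt_inf v) vu.
have vuX : v (iota (u ^+ (p ^ m))) = VFin 0.
  by rewrite rmorphXn -(v_one v) -(expr1n _ (p ^ m)); apply: v_expE; rewrite v_one.
have suO : iota (s u ^+ (p ^ m) / u ^+ (p ^ m)) \in vring v.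
  rewrite inE fmorph_div v_le_div ?fmorph_eq0 // vuX.
  by rewrite -[s u ^+ _](rmorphXn (gal_rmorphism s)) gal_isometry // vuX.
apply/eqP; rewrite -subr_eq0 -(red1 v) -redB ?rpred1 // red_eq0 ?rpredB ?rpred1 //.
rewrite -(rmorph1 iota) -rmorphB -[X in _ - X](divff u0) -mulrBl fmorph_div v_lt_div ?fmorph_eq0 //.
rewrite vuX -[s u ^+ _](rmorphXn (gal_rmorphism s)) /=.
(* Both u^(p^m) and its image under s are close to l, which s fixes. *)
rewrite -(subrKA l%:A) rmorphD v_gt_add //; last by rewrite -opprB rmorphN v_opp.
rewrite -(gal_base s l) -[s _ - s _](rmorphB (gal_rmorphism s)) /=.
by rewrite gal_isometry.
Qed.

Variable a : Omega.
Hypothesis gen : forall z, exists q : {poly K}, z = (map_poly (in_alg Omega) q).[a].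

Lemma purely_wild_base : purely_wild v KK (range iota) ->
  range iota `&` abs_ramification_field v KK = KK.
Proof.
move=> wild; apply/seteqP; split=> [_ [[z _ <-] /(ramfieldP algM galO hens gen)]|_ [k _ <-]].
  move=> zfix; have [|k ->] := gal_fixed_base galO (z := z); last by exists k.
  by move=> s; apply/zfix/(purely_wild_ramified s wild).
split; first by exists k%:A.
by apply/(ramfieldP algM galO hens gen) => s _; apply: gal_base.
Qed.

End PurelyWild.

Theorem theorem1p6 (K : fieldType) (Omega : splittingFieldType K)
  (Kbar : closedFieldType) (iota : {rmorphism Omega -> Kbar})
  (G : oagType) (v : valuation Kbar G) (a : Kbar) :
  let KK : set Kbar := base_set iota in
  let OO : set Kbar := range iota in
  let L : set Kbar := OO `&` abs_ramification_field v KK in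
  let Ram : set (set Omega) := ramification_ideals (val_pullback iota v) in
  (forall x : Kbar, algebraicOver (fun c : K => iota c%:A) x) ->
  galois 1 {:Omega} ->
  henselian v KK ->
  nontrivially_valued v KK ->
  ext_depth v KK OO = 1%N ->
  ~ tame v KK OO ->
  generator KK OO a ->
  pure v KK a ->
  [/\ Ram #<= conj_dist v L a,
      purely_wild v KK OO -> Ram #<= conj_dist v KK a &
      defectless v KK OO \/ rank_one (value_group v KK) ->
        Ram #= conj_dist v L a /\
        (purely_wild v KK OO -> Ram #= conj_dist v KK a)].
Proof.
move=> KK OO L Ram algM galO hens _ _ _ genO pure_a.
have algj : forall x, algebraicOver (base_map iota) x by exact: algM.
have [a0 aE] : exists a0, iota a0 = a.
  have : OO a by rewrite genO => F [_]; apply; right.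
  by move=> [a0 _ <-]; exists a0.
subst a; have gen z : exists q : {poly K}, z = (map_poly (in_alg Omega) q).[a0].
  have : adjoin KK (iota a0) (iota z) by rewrite -genO; exists z.
  rewrite [adjoin _ _](adjoinE algj) => -[q _ qz]; exists q.
  by apply: (fmorph_inj iota); rewrite -qz map_poly_base horner_map.
have RamE := ramification_idealsE algj galO hens gen pure_a.
have le : Ram #<= conj_dist v L (iota a0) by rewrite /Ram RamE; apply: card_image_le.
have eq : defectless v KK OO \/ rank_one (value_group v KK) ->
    Ram #= conj_dist v L (iota a0).
  move=> dr; rewrite /Ram RamE; apply: inj_card_eq; case: dr => [dl|r1].
    have [|k kmax] := defectless_max a0 _ dl.
      by rewrite (ext_degree_dim iota) adim_gt0.
    exact: max_approx_ideal_inj kmax.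
  exact: rank_one_approx_ideal_inj.
have LK : purely_wild v KK OO -> L = KK by apply: (purely_wild_base algj galO hens gen).
split=> // [/LK <-//|dr]; split; first exact: eq.
by move=> /LK <-; apply: eq.
Qed.
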